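(* Let $g,n\ge0$ be integers with $2g+n\ge4$, and put $d=6g-6+2n$, $\ell=4g-4+n$; for pairs $(g_i,n_i)$ put $d_i=6g_i-6+2n_i$, $\ell_i=4g_i-4+n_i$. Treat all intersection numbers of $\psi$-classes as formal variables $\langle\tau_{d_1}\cdots\tau_{d_m}\rangle$, and let $\mathcal{V}_{g',n'}$ be the formal volume polynomials in these variables defined in the context. Then the following identities between polynomials in the formal variables hold. (i) If $g\ge1$, then $$\frac{3}{\pi^2}\sum_{\Gamma\in\mathcal{G}_{g,n}}\mathcal{Z}(\partial_\Gamma P_\Gamma)=\frac18\sum_{\substack{g_1+g_2=g,\ n_1+n_2=n+2\\ g_i\ge0,\ n_i\ge1,\ d_i\ge0}}\frac{\ell!}{\ell_1!\,\ell_2!}\cdot\frac{n!}{(n_1-1)!\,(n_2-1)!}\cdot\frac{(d_1-1)!\,(d_2-1)!}{(d-1)!}\,\mathcal{V}_{g_1,n_1}\mathcal{V}_{g_2,n_2}+\frac{\ell!}{(\ell-2)!}\cdot\frac{(d-3)!}{(d-1)!}\,\mathcal{V}_{g-1,n+2}.$$ (ii) If $g=0$, then $$\frac{3}{\pi^2}\sum_{\Gamma\in\mathcal{G}_{0,n}}\mathcal{Z}(\partial_\Gamma P_\Gamma)=\frac18\sum_{\substack{n_1+n_2=n+2\\ n_i\ge3}}\frac{(n-4)!}{(n_1-4)!\,(n_2-4)!}\cdot\frac{n!}{(n_1-1)!\,(n_2-1)!}\cdot\frac{(2n_1-7)!\,(2n_2-7)!}{(2n-7)!}\,\mathcal{V}_{0,n_1}\mathcal{V}_{0,n_2}.$$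 Here, whenever $(g_i,n_i)=(0,3)$, the ratio $\frac{(d_i-1)!}{\ell_i!}=\frac{(2n_i-7)!}{(n_i-4)!}$ is by convention equal to $\frac12$.
   Context: (The right-hand sides are expressions for $\operatorname{Vol}(\mathcal{Q}_{g,n})\,c_{\mathrm{area}}(\mathcal{Q}_{g,n})$ known from earlier work, with the Masur--Veech volumes $\operatorname{Vol}\mathcal{Q}_{g',n'}$ replaced by their expressions as polynomials in intersection numbers.) **Formal variables.** For each multiset $\{d_1,\dots,d_m\}$ of nonnegative integers with $d_1+\dots+d_m=3h-3+m$ for some $h\ge0$, $2h-2+m>0$, introduce a formal commuting variable $\langle\tau_{d_1}\cdots\tau_{d_m}\rangle$ (symmetric in its entries). Coefficients are real numbers. **Stable graphs.** $\mathcal{G}_{g,n}$ is the finite set of isomorphism classes of stable graphs of genus $g$ with $n$ legs: connected graphs $\Gamma$ (loops and multiple edges allowed) with vertex set $V(\Gamma)$, edge set $E(\Gamma)$, $n$ legs labeled $1,\dots,n$, and a nonnegative integer $g_v$ at each vertex $v$, such that $g=h^1(\Gamma)+\sum_v g_v$ and $2g_v-2+n_v>0$ for each $v$, where $n_v$ is the valency of $v$ (legs counted, loops counted twice). $\operatorname{Aut}(\Gamma)$ is the group of automorphisms (acting on vertices and half-edges) preserving the genus decoration and the labels of the legs. **Polynomials.** For $n\ge1$, $(g,n)\ne(0,1),(0,2)$ put $$N_{g,n}(b_1,\dots,b_n)=\sum_{d_1+\dots+d_n=3g-3+n}\frac{\langle\tau_{d_1}\cdots\tau_{d_n}\rangle}{2^{5g-6+2n}\,d_1!\cdots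 d_n!}\,b_1^{2d_1}\cdots b_n^{2d_n}.$$ For $\Gamma\in\mathcal{G}_{g,n}$ assign a variable $b_e$ to each edge; for a vertex $v$ let $\boldsymbol{b}_v$ be the $n_v$-tuple with one entry $b_e$ for each half-edge at $v$ belonging to an edge $e$ (twice for a loop) and one entry $0$ for each leg at $v$. Put $$P_\Gamma(\boldsymbol{b})=\frac{2^{6g-5+2n}(4g-4+n)!}{(6g-7+2n)!}\cdot\frac{1}{2^{|V(\Gamma)|-1}}\cdot\frac{1}{|\operatorname{Aut}(\Gamma)|}\prod_{e\in E(\Gamma)}b_e\prod_{v\in V(\Gamma)}N_{g_v,n_v}(\boldsymbol{b}_v),$$ with contribution zero for the graph with no edges when $2g+n\ge4$. $\mathcal{Z}$ is the operator, linear over the ring of polynomials in the formal variables, given on monomials with positive exponents by $\mathcal{Z}\big(\prod_i b_i^{m_i}\big)=\prod_i m_i!\,\zeta(m_i+1)$. **The operator $\partial_\Gamma$.** For $e\in E(\Gamma)$ let $\chi_\Gamma(e)=\frac12$ if $e$ is a bridge and $\chi_\Gamma(e)=1$ otherwise; $\partial_\Gamma P=\sum_{e\in E(\Gamma)}\chi_\Gamma(e)\,b_e\cdot\left.\frac{\partial P}{\partial b_e}\right|_{b_e=0}$. **Formal volumes.** For $2g'+n'\ge4$, $\mathcal{V}_{g',n'}=\sum_{\Gamma\in\mathcal{G}_{g',n'}}\mathcal{Z}(P_\Gamma)$. By convention $\mathcal{V}_{0,3}=4\langle\tau_0^3\rangle$ and $\mathcal{V}_{1,1}=\frac{2\pi^2}{3}\langle\tau_0^3\rangle$.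 *)

(* Defs.v *)
From HB Require Import structures.
From mathcomp Require Import all_boot all_order all_algebra finmap multiset.
From mathcomp Require Import -(notations) monalg.
From mathcomp Require Import mpoly.
From mathcomp Require Import reals topology normedtype sequences trigo.
From mathcomp Require Import zify.

Set Implicit Arguments.
Unset Strict Implicit.
Unset Printing Implicit Defensive.

Import Order.TTheory GRing.Theory Num.Theory numFieldNormedType.Exports.

Local Open Scope ring_scope.

(* Formal variables: the multiset {d_1, ..., d_m} indexes a variable when
   d_1 + ... + d_m = 3h - 3 + m and 2h - 2 + m > 0 for some h, which is then
   at most d_1 + ... + d_m + 3. *)

Definition tau_valid (D : {mset nat}%mset) : bool :=
  [exists h : 'I_(\sum_(x <- D) x + 4)%N,
     ((\sum_(x <- D) x + 3 == 3 * h + size D) && (2 < 2 * h + size D))%N].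

Definition tau_index := {D : {mset nat}%mset | tau_valid D}.

(* The notations of monalg are not imported: its {mpoly R[n]} hides that of
   mpoly. *)
Notation formal_poly R := (malg (cmonom tau_index) R).

(* The junk value 0 is only taken when s does not index a variable, which
   does not occur in the polynomials N_{g,n} with 2g - 2 + n > 0 below. *)
Definition tau (R : realType) (s : seq nat) : formal_poly R :=
  if insub (seq_mset s) is Some i then mkmalgU (ucm i) 1 else 0.

(* Truncated subtraction: 5g - 6 + 2n >= 0 and 3g - 3 + n >= 0 as soon as
   2g - 2 + n > 0 and n > 0. *)
Definition Npoly (R : realType) (g n : nat) : {mpoly (formal_poly R)[n]} :=
  \sum_(d : {ffun 'I_n -> 'I_(3 * g + n)} |
          (\sum_i d i + 3 == 3 * g + n)%N)
    ((2 ^+ (5 * g + 2 * n - 6) * \prod_i (d i)`!%:R)^-1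
       *: tau R [seq nat_of_ord (d i) | i <- enum 'I_n])
    *: \prod_i 'X_i ^+ (2 * d i).

(* Decorated graphs with k vertices, m edges and n labeled legs. The half-edges
   of edge e that are not legs are (e, false) and (e, true). Vertex genera are
   bounded by the total genus g, as they are in any graph of genus g. *)

Definition dgraph (g n k m : nat) : finType :=
  ({ffun 'I_k -> 'I_g.+1} * {ffun 'I_m * bool -> 'I_k}
   * {ffun 'I_n -> 'I_k})%type.

Section DecoratedGraph.
Context {g n k m : nat}.
Implicit Types (G : dgraph g n k m) (v : 'I_k) (e : 'I_m).

Definition vgenus G : {ffun 'I_k -> 'I_g.+1} := G.1.1.
Definition vertex_of G : {ffun 'I_m * bool -> 'I_k} := G.1.2.
Definition leg_vertex G : {ffun 'I_n -> 'I_k} := G.2.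

Definition halfedges_at G v : {set 'I_m * bool} := [set x | vertex_of G x == v].
Definition legs_at G v : {set 'I_n} := [set i | leg_vertex G i == v].
Definition valency G v : nat := (#|halfedges_at G v| + #|legs_at G v|)%N.

Definition opposite (x : 'I_m * bool) : 'I_m * bool := (x.1, ~~ x.2).

Definition adjacent G (S : {set 'I_m}) : rel 'I_k :=
  [rel u v | [exists x : 'I_m * bool,
     [&& x.1 \in S, vertex_of G x == u & vertex_of G (opposite x) == v]]].

Definition connected_by G (S : {set 'I_m}) : bool :=
  (0 < k)%N && [forall u, forall v, connect (adjacent G S) u v].

Definition is_bridge G e : bool := ~~ connected_by G (~: [set e]).

(* |E| - |V| + 1, for connected graphs *)
Definition betti1 G : nat := (m.+1 - k)%N.

Definition is_stable G : bool :=
  [&& connected_by G [set: 'I_m],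
      (g == betti1 G + \sum_v vgenus G v)%N
    & [forall v, (2 < 2 * vgenus G v + valency G v)%N]].

End DecoratedGraph.

(* p on vertices and q on non-leg half-edges form an isomorphism; the label of
   a leg is preserved, so there is no choice for its image. *)
Definition is_iso (g n k m k' m' : nat)
    (G : dgraph g n k m) (G' : dgraph g n k' m')
    (p : {ffun 'I_k -> 'I_k'}) (q : {ffun 'I_m * bool -> 'I_m' * bool}) : bool :=
  [&& (k == k') && injectiveb p, (m == m') && injectiveb q,
      [forall x, q (opposite x) == opposite (q x)],
      [forall x, vertex_of G' (q x) == p (vertex_of G x)],
      [forall v, vgenus G' (p v) == vgenus G v]
    & [forall i, leg_vertex G' i == p (leg_vertex G i)]].

Definition isomorphic (g n k m k' m' : nat)
    (G : dgraph g n k m) (G' : dgraph g n k' m') : bool :=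
  [exists p, exists q, is_iso G G' p q].

Definition graph_automorphisms (g n k m : nat) (G : dgraph g n k m) :
    {set {ffun 'I_k -> 'I_k} * {ffun 'I_m * bool -> 'I_m * bool}} :=
  [set pq | is_iso G G pq.1 pq.2].

(* A stable graph has at most 2g - 2 + n vertices and 3g - 3 + n edges (see
   stable_bounds), so that these bounds on k and m do not exclude any graph. *)
Definition any_dgraph (g n : nat) : finType :=
  {km : 'I_(2 * g + n) * 'I_(3 * g + n) & dgraph g n km.1 km.2}.

(* One representative in each isomorphism class. *)
Definition stable_graphs (g n : nat) : {set any_dgraph g n} :=
  let D := [set G : any_dgraph g n | is_stable (tagged G)] in
  transversal
    (equivalence_partition
       [rel G G' : any_dgraph g n | isomorphic (tagged G) (tagged G')] D) D.

Definition zeta (R : realType) (s : nat) : R :=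
  limn (fun N => \sum_(0 <= i < N) (i.+1%:R ^+ s)^-1 : R).

Section GraphPolynomials.
Context {R : realType} {g n k m : nat}.
Implicit Type G : dgraph g n k m.

Local Notation K := (formal_poly R).

(* The tuple b_v; its size is the valency of v (see size_bvec). *)
Definition bvec G (v : 'I_k) : seq {mpoly K[m]} :=
  [seq 'X_(x.1) | x : 'I_m * bool <- enum (halfedges_at G v)]
  ++ [seq 0 | i : 'I_n <- enum (legs_at G v)].

Definition Pconst G : R :=
  (2 ^+ (6 * g + 2 * n - 5) * (4 * g + n - 4)`!%:R / (6 * g + 2 * n - 7)`!%:R)
  * (2 ^+ k.-1)^-1 * (#|graph_automorphisms G|%:R)^-1.

Definition Pgraph G : {mpoly K[m]} :=
  if (m == 0)%N && (4 <= 2 * g + n)%N then 0 else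
  ((Pconst G)%:A : K) *:
    (\prod_(e < m) 'X_e *
     \prod_(v < k) (Npoly R (vgenus G v) (size (bvec G v))
                      \mPo in_tuple (bvec G v))).

Definition chi G (e : 'I_m) : R := if is_bridge G e then 2^-1 else 1.

Definition set_zero (e : 'I_m) (p : {mpoly K[m]}) : {mpoly K[m]} :=
  p \mPo [tuple if i == e then 0 else 'X_i | i < m].

Definition partial_graph G (p : {mpoly K[m]}) : {mpoly K[m]} :=
  \sum_(e < m) ((chi G e)%:A : K) *: ('X_e * set_zero e p^`M(e)).

(* Only meaningful on polynomials all of whose monomials have positive
   exponents in every variable, since zeta 1 is divergent. *)
Definition Zop (p : {mpoly K[m]}) : K :=
  \sum_(u <- msupp p) (\prod_i ((u i)`!%:R * zeta R (u i).+1) : R) *: p@_u.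

End GraphPolynomials.

Arguments Pgraph R {g n k m} G.

Definition formal_volume (R : realType) (g n : nat) : formal_poly R :=
  if (g == 0)%N && (n == 3)%N then (4 : R) *: tau R [:: 0; 0; 0]%N
  else if (g == 1)%N && (n == 1)%N then
    (2 * pi ^+ 2 / 3 : R) *: tau R [:: 0; 0; 0]%N
  else \sum_(G in stable_graphs g n) Zop (Pgraph R (tagged G)).

(* (d - 1)! / l! with d = 6g - 6 + 2n and l = 4g - 4 + n, set to 1/2 at (0,3),
   where it would be (-1)! / (-1)!. *)
Definition dl_ratio (R : realType) (g n : nat) : R :=
  if (g == 0)%N && (n == 3)%N then 2^-1
  else (6 * g + 2 * n - 7)`!%:R / (4 * g + n - 4)`!%:R.

Lemma size_bvec (R : realType) (g n k m : nat) (G : dgraph g n k m) (v : 'I_k) :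
  size (bvec (R := R) G v) = valency G v.
Proof. by rewrite size_cat !size_map -!cardE. Qed.

Lemma sum_valency (g n k m : nat) (G : dgraph g n k m) :
  (\sum_v valency G v = 2 * m + n)%N.
Proof.
rewrite big_split /=; congr (_ + _)%N.
  transitivity #|{: 'I_m * bool}|; last by rewrite card_prod card_ord card_bool mulnC.
  rewrite -sum1_card (partition_big (vertex_of G) predT) //=.
  by apply: eq_bigr => v _; rewrite -sum1_card; apply: eq_bigl => x; rewrite inE.
transitivity #|{: 'I_n}|; last by rewrite card_ord.
rewrite -sum1_card (partition_big (leg_vertex G) predT) //=.
by apply: eq_bigr => v _; rewrite -sum1_card; apply: eq_bigl => x; rewrite inE.
Qed.

Lemma stable_bounds (g n k m : nat) (G : dgraph g n k m) :
  is_stable G -> (k + 2 <= 2 * g + n)%N /\ (m + 3 <= 3 * g + n)%N.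
Proof.
case/and3P => _ /eqP genusE /forallP stab.
have : (\sum_(v < k) 3 <= \sum_(v < k) (2 * vgenus G v + valency G v))%N.
  by apply: leq_sum => v _; apply: stab.
rewrite sum_nat_const card_ord big_split /= -big_distrr /= sum_valency.
move: genusE; rewrite /betti1; set S := (\sum_v vgenus G v)%N => genusE.
by move=> ?; lia.
Qed.

(* Main.v *)
Require Import Defs.
From mathcomp Require Import all_boot all_order all_algebra perm finmap multiset.
From mathcomp Require Import -(notations) monalg.
From mathcomp Require Import mpoly.
From mathcomp Require Import reals topology normedtype sequences derive trigo.
From mathcomp Require Import zify ring lra.

Set Implicit Arguments.
Unset Strict Implicit.
Unset Printing Implicit Defensive.

Import Order.TTheory GRing.Theory Num.Theory numFieldNormedType.Exports.

Local Open Scope ring_scope.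

(** The polynomial N_{g,n} is even in each variable, so that P_Gamma is a
    combination of the monomials prod_e b_e^(2 s_e + 1), where s_e is the sum
    of the exponents d chosen at the two halves of e. The operator
    b_e (d/db_e) at b_e = 0 keeps the monomials with s_e = 0 and kills the
    others. In a surviving monomial both halves of e have exponent 0, exactly
    as legs do, and Z turns the factor b_e into zeta(2) = pi^2 / 6 ([zeta2]).
    Hence Z(partial_Gamma P_Gamma) is, up to constants, the sum over the edges e
    of chi(e) times the value of the graph in which e is cut into two legs
    ([weight_cut], [Zop_partial]).

    Both sides of the identity are sums over isomorphism classes weighted by
    1 / |Aut|. By orbit counting such a sum is a sum over graphs with k numbered
    vertices and m numbered, oriented edges, weighted by 1 / (k! m! 2^m)
    ([orbit_stabiliser], [sum_stable_graphs]). For numbered graphs, cutting the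
    edge e is a bijection onto graphs with one edge less and two more legs
    ([sum_cut]), and a graph of the latter kind is of one of two types.
    - If it is connected, it is a stable graph of genus g - 1 with n + 2 legs,
      and these graphs add up to the volume V_{g-1,n+2}.
    - If it is disconnected, then e was a bridge, and the graph is an ordered
      pair of stable graphs, the first one being that which contains the first
      half of e; genera add, and vertices, edges and legs are distributed over
      the two sides ([componentsE], [sum_bridged]). The numbers of ways to
      distribute vertices and edges are binomial coefficients, and turn
      1 / (k! m! 2^m) into the product of the weights of the two sides, as in a
      product of exponential generating functions, so that these graphs add up
      to products of two volumes; the binomial coefficient for the legs stays in
      the formula ([omegaD], [sum_cut_total]).

    Every volume is an explicit constant times the same sum over numbered graphs
    ([formal_volumeE]). This includes the exceptional values at (0,3) and (1,1),
    which are the contributions of the graphs with one vertex ([total_0_3],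
    [total_1_1]). In all other cases the graphs without edges drop out by
    themselves, because N_{g,n} has no constant term unless 3g - 3 + n = 0
    ([labelled_no_edge]). It remains to compare the constants
    ([split_coefficient], [loop_coefficient], [basel_coefficient]). *)

(** * The value of zeta at 2 *)
Section Basel.
Context {R : realType}.
Implicit Types x : R.

Lemma sin_lex x : 0 < x -> sin x <= x.
Proof.
move=> x0; have [|c _] := @MVT R sin cos 0 x x0 (fun y _ => is_derive_sin y).
  by apply: continuous_subspaceT => y; exact: continuous_sin.
rewrite sin0 !subr0 => ->; rewrite -[leRHS]mul1r.
by apply: ler_wpM2r; rewrite ?cos_le1 // ltW.
Qed.

Lemma le_tanx x : 0 < x < pi / 2 -> x <= tan x.
Proof.
case/andP=> x0 xpi; have cos_gt0 y : 0 <= y <= x -> 0 < cos y.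
  by case/andP=> y0 yx; apply: cos_gt0_pihalf;
    rewrite (le_lt_trans yx xpi) andbT (lt_le_trans _ y0) // oppr_lt0 divr_gt0 ?pi_gt0.
have [y yx||c cx] := @MVT R tan (fun y => cos y ^- 2) 0 x x0.
- apply: is_derive_tan; rewrite gt_eqF // cos_gt0 //.
  by move: yx; rewrite in_itv /= => /andP [/ltW -> /ltW ->].
- apply: continuous_in_subspaceT => y; rewrite classical_sets.inE /= in_itv /= => yx.
  by apply: continuous_tan; rewrite gt_eqF // cos_gt0.
rewrite tan0 !subr0 => ->; rewrite -[leLHS]mul1r.
apply: ler_wpM2r; first exact: ltW.
rewrite invr_ge1 ?exprn_ile1 ?cos_le1 //; last 2 first.
- by rewrite unitfE gt_eqF // exprn_gt0 // cos_gt0 //; move: cx; rewrite in_itv /= => /andP [/ltW -> /ltW ->].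
- by rewrite exprn_gt0 // cos_gt0 //; move: cx; rewrite in_itv /= => /andP [/ltW -> /ltW ->].
by rewrite ltW // cos_gt0 //; move: cx; rewrite in_itv /= => /andP [/ltW -> /ltW ->].
Qed.

(** From sin x < x < tan x, since 1 / tan^2 = 1 / sin^2 - 1. A sum of these
    bounds over N points determines the sum of 1 / x^2 up to an error N. *)
Lemma csc2_bounds x : 0 < x < pi / 2 ->
  sin x ^- 2 - 1 <= x ^- 2 <= sin x ^- 2.
Proof.
move=> xb; have /andP [x0 xpi] := xb.
have s0 : 0 < sin x by apply: sin_gt0_pihalf.
have c0 : 0 < cos x by apply: cos_gt0_pihalf; rewrite xpi andbT (lt_trans _ x0) // oppr_lt0 divr_gt0 ?pi_gt0.
apply/andP; split; last first.
  by rewrite lef_pV2 ?posrE ?exprn_gt0 // ler_pXn2r ?nnegrE ?(ltW s0) ?(ltW x0) ?sin_lex.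
have -> : sin x ^- 2 - 1 = tan x ^- 2.
  transitivity ((1 - sin x ^+ 2) / sin x ^+ 2); first by field; rewrite gt_eqF.
  by rewrite -cos2sin2 /tan; field; rewrite !gt_eqF.
have h := le_tanx xb; have t0 := lt_le_trans x0 h.
by rewrite lef_pV2 ?posrE ?exprn_gt0 // ler_pXn2r ?nnegrE ?(ltW x0) ?(ltW t0).
Qed.

(** This is 1 / sin^2 + 1 / cos^2 = 4 / sin^2(2x). *)
Lemma csc2_half x : 0 < x < pi / 2 ->
  sin x ^- 2 + sin (pi / 2 - x) ^- 2 = 4 * sin (x *+ 2) ^- 2.
Proof.
move=> /[dup] xb /andP [x0 xpi].
have s0 : sin x != 0 by rewrite gt_eqF // sin_gt0_pihalf.
have c0 : cos x != 0 by rewrite gt_eqF // cos_gt0_pihalf // xpi andbT (lt_trans _ x0) // oppr_lt0 divr_gt0 ?pi_gt0.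
rewrite sinB sin_pihalf cos_pihalf mul1r mul0r subr0 sin_mulr2n.
transitivity ((cos x ^+ 2 + sin x ^+ 2) / (cos x * sin x) ^+ 2).
  by rewrite exprMn; field; rewrite c0 s0.
by rewrite cos2Dsin2 -mulr_natl; field; rewrite c0 s0.
Qed.

Local Notation ang n k := (k%:R * (pi / 2 ^+ n.+1) : R).

Lemma ang_bnd n k : (1 <= k < 2 ^ n)%N -> 0 < ang n k < pi / 2.
Proof.
case/andP=> k1 k2; have p2 : (0 < 2 ^+ n :> R) by rewrite exprn_gt0.
have -> : ang n k = pi / 2 * (k%:R / 2 ^+ n) by rewrite exprS; field; rewrite gt_eqF.
have pi2 : 0 < pi / 2 :> R by rewrite divr_gt0 ?pi_gt0.
apply/andP; split; first by rewrite mulr_gt0 // divr_gt0 ?ltr0n.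
by rewrite -[ltRHS]mulr1 ltr_pM2l // ltr_pdivrMr // mul1r -natrX ltr_nat.
Qed.

(** Doubling the number of points: pairing k with 2^(n+1) - k, the sum for n + 1
    is four times the sum for n plus the term 1 / sin^2(pi / 4) = 2. *)
Lemma sum_csc2 n :
  \sum_(1 <= k < 2 ^ n) sin (ang n k) ^- 2 = (4 ^+ n.+1 - 4) / 6 :> R.
Proof.
have p2 m : (2 ^+ m != 0 :> R) by rewrite expf_neq0 // pnatr_eq0.
have p2' m : (0 < 2 ^+ m :> R) by rewrite exprn_gt0.
elim: n => [|n IH]; first by rewrite big_geq // expr1 subrr mul0r.
have le1 : (1 <= 2 ^ n)%N by rewrite expn_gt0.
have le2 : (2 ^ n <= 2 ^ n.+1)%N by rewrite leq_exp2l.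
rewrite (@big_cat_nat _ _ _ (2 ^ n)) //= (@big_ltn _ _ _ (2 ^ n)) ?ltn_exp2l //=.
have -> : \sum_((2 ^ n).+1 <= k < 2 ^ n.+1) sin (ang n.+1 k) ^- 2
    = \sum_(1 <= k < 2 ^ n) sin (pi / 2 - ang n.+1 k) ^- 2 :> R.
  rewrite -[(2 ^ n).+1]add1n big_addn.
  have -> : (2 ^ n.+1 - 2 ^ n)%N = (2 ^ n)%N by rewrite expnS mul2n -addnn addnK.
  rewrite big_nat_rev /=; apply: eq_big_nat => k /andP [k1 k2].
  congr (sin _ ^- 2); rewrite subSS.
  have -> : (1 + 2 ^ n - k.+1 + 2 ^ n = 2 ^ n.+1 - k)%N by rewrite expnS; lia.
  rewrite natrB; last by rewrite expnS; lia.
  by rewrite natrX; rewrite !exprS; field; rewrite p2.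
have -> : sin (ang n.+1 (2 ^ n)) ^- 2 = 2 :> R.
  have -> : ang n.+1 (2 ^ n) = pi / 4 by rewrite natrX !exprS; field; rewrite p2.
  have h : cos (pi / 4) ^+ 2 *+ 2 - 1 = 0 :> R.
    by rewrite -cos_mulr2n -(cos_pihalf R); congr (cos _); field.
  have -> : sin (pi / 4) ^+ 2 = 2^-1 :> R by rewrite sin2cos2; lra.
  by rewrite invrK.
rewrite addrCA -big_split /= (eq_big_nat _ _ (F2 := fun k => 4 * sin (ang n k) ^- 2)) => [|k /andP [k1 k2]].
  by rewrite -big_distrr /= IH !exprS; field.
rewrite csc2_half; last first.
  by apply: ang_bnd; rewrite k1 (leq_trans k2 le2).
by congr (4 * sin _ ^- 2); rewrite !exprS -mulr_natl; field; rewrite p2.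
Qed.

(** The points k pi / 2^(n+1) lie in (0, pi / 2), so the partial sums of k^-2 are
    squeezed between multiples of the closed sums of 1 / sin^2, with a relative
    error of order 2^-n. *)
Lemma zeta2 : zeta R 2 = pi ^+ 2 / 6.
Proof.
pose u (N : nat) : R := \sum_(0 <= i < N) (i.+1%:R ^+ 2)^-1.
have p2' m : (0 < 2 ^+ m :> R) by rewrite exprn_gt0.
have pi0 : 0 < pi :> R := pi_gt0 R.
have e4 : 2 ^+ 2 = 4 :> R by rewrite -natrX.
have u_incr : nondecreasing_seq u.
  apply/nondecreasing_seqP => n; rewrite /u big_nat_recr //= lerDl.
  by rewrite invr_ge0 exprn_ge0.
have uE n : u (2 ^ n).-1 = \sum_(1 <= k < 2 ^ n) k%:R ^- 2.
  by rewrite big_add1.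
have kE n k : (1 <= k)%N -> k%:R ^- 2 = (pi / 2 ^+ n.+1) ^+ 2 * (ang n k) ^- 2 :> R.
  move=> k1; have k0 : k%:R != 0 :> R by rewrite pnatr_eq0 -lt0n.
  have aux (a c x : R) : a != 0 -> c != 0 -> x != 0 -> x ^- 2 = (a / c) ^+ 2 * (x * (a / c)) ^- 2.
    by move=> a0 c0 y0; field; rewrite a0 c0 y0.
  by apply: aux => //; rewrite gt_eqF.
have u_le n : u (2 ^ n).-1 <= pi ^+ 2 / 6.
  rewrite uE (eq_big_nat _ _ (fun k kb => kE n k (proj1 (andP kb)))) -big_distrr /=.
  have h : \sum_(1 <= k < 2 ^ n) (ang n k) ^- 2 <= (4 ^+ n.+1 - 4) / 6 :> R.
    rewrite -sum_csc2; apply: ler_sum_nat => k kb.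
    by have /andP [_ ->] := csc2_bounds (ang_bnd kb).
  apply: le_trans (ler_wpM2l _ h) _; first by rewrite exprn_ge0 // divr_ge0 ?ltW.
  have -> : 4 ^+ n.+1 = (2 ^+ n.+1) ^+ 2 :> R by rewrite exprAC e4.
  have a0 : 0 < 2 ^+ n.+1 :> R := p2' _; move: (2 ^+ n.+1) a0 => a a0.
  have -> : (pi / a) ^+ 2 * ((a ^+ 2 - 4) / 6) = pi ^+ 2 / 6 * (1 - 4 / a ^+ 2).
    by move: (pi : R) => P; field; rewrite gt_eqF.
  apply: ler_piMr; first by rewrite divr_ge0 // exprn_ge0 // ltW.
  by rewrite gerBl divr_ge0 // exprn_ge0 // ltW.
have u_ge n : pi ^+ 2 / 6 - pi ^+ 2 / 2 ^+ n <= u (2 ^ n).-1.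
  rewrite uE (eq_big_nat _ _ (fun k kb => kE n k (proj1 (andP kb)))) -big_distrr /=.
  have h : (4 ^+ n.+1 - 4) / 6 - 2 ^+ n <= \sum_(1 <= k < 2 ^ n) (ang n k) ^- 2 :> R.
    rewrite -sum_csc2; apply: (@le_trans _ _ (\sum_(1 <= k < 2 ^ n) (sin (ang n k) ^- 2 - 1))).
      rewrite sumrB lerD2l lerN2 sumr_const_nat -natrX ler_nat; lia.
    apply: ler_sum_nat => k kb.
    by have /andP [-> _] := csc2_bounds (ang_bnd kb).
  apply: le_trans (ler_wpM2l _ h); last by rewrite exprn_ge0 // divr_ge0 ?ltW.
  have -> : 4 ^+ n.+1 = 4 * (2 ^+ n) ^+ 2 :> R by rewrite exprS exprAC e4.
  rewrite [2 ^+ n.+1]exprS; set a : R := 2 ^+ n.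
  have a1 : 1 <= a by rewrite /a -natrX ler1n expn_gt0.
  have -> : (pi / (2 * a)) ^+ 2 * ((4 * a ^+ 2 - 4) / 6 - a)
      = pi ^+ 2 / 6 - pi ^+ 2 / a * (1 / 6 / a + 1 / 4).
    by move: (pi : R) => P; field; rewrite gt_eqF // (lt_le_trans _ a1).
  rewrite lerD2l lerN2; apply: ler_piMr.
    by rewrite divr_ge0 ?exprn_ge0 ?(ltW pi0) // (le_trans ler01 a1).
  have : a^-1 <= 1 by rewrite invf_le1 // (lt_le_trans _ a1).
  by lra.
have u_bnd N : u N <= pi ^+ 2 / 6.
  apply: le_trans (u_le N); apply: u_incr; have := ltn_expl N (ltnSn 1); lia.
have u_cvg : cvgn u.
  apply: nondecreasing_is_cvgn => //; exists (pi ^+ 2 / 6) => _ [N _ <-]; exact: u_bnd.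
rewrite /zeta -/u; apply/eqP; rewrite eq_le; apply/andP; split.
  by apply: limr_le => //; apply: filterE.
apply/ler_addgt0Pr => e e0.
have [n hn] : exists n, pi ^+ 2 / 2 ^+ n <= e.
  have := truncnS_gt (pi ^+ 2 / e); set n := (Num.truncn _).+1 => hn; exists n.
  have h2n : n%:R <= 2 ^+ n :> R by rewrite -natrX ler_nat ltnW // ltn_expl.
  rewrite ler_pdivrMr // [e * _]mulrC -ler_pdivrMr //.
  exact: le_trans (ltW hn) h2n.
have := nondecreasing_cvgn_le u_incr u_cvg (2 ^ n).-1.
by have := u_ge n; lra.
Qed.

End Basel.

(** * Labelled graphs, their isomorphisms and weights *)
(** Vertices, edges and legs range over arbitrary finite types, so that cutting an
    edge and joining two graphs only change these types, by bool and by disjoint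
    sums. The number b bounds the genera of the vertices; the genus of the graph is
    a separate parameter below. *)
Definition graph (b : nat) (V E L : finType) : finType :=
  ({ffun V -> 'I_b.+1} * {ffun E * bool -> V} * {ffun L -> V})%type.

Notation numbered_graph g n k m := (graph g 'I_k 'I_m 'I_n).

Definition flip (E : finType) (x : E * bool) : E * bool := (x.1, ~~ x.2).

Lemma flipK E : involutive (@flip E).
Proof. by case=> e []. Qed.

Section GraphData.
Context {b : nat} {V E L : finType}.
Implicit Types (G : graph b V E L) (S : {set E}) (v : V).

Definition gen G : {ffun V -> 'I_b.+1} := G.1.1.
Definition vtx G : {ffun E * bool -> V} := G.1.2.
Definition leg G : {ffun L -> V} := G.2.

Definition hedges G v : {set E * bool} := [set x | vtx G x == v].
Definition legs G v : {set L} := [set i | leg G i == v].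

Definition adj G S : rel V :=
  [rel u v | [exists x : E * bool,
     [&& x.1 \in S, vtx G x == u & vtx G (flip x) == v]]].

Definition conn G S : bool := [forall u, forall v, connect (adj G S) u v].

Definition vstable G : bool :=
  [forall v, (2 < 2 * gen G v + (#|hedges G v| + #|legs G v|))%N].

(** The equation h = |E| - |V| + 1 + sum of the genera, written without
    subtraction so that it makes sense for disconnected graphs too. *)
Definition has_genus (h : nat) G : bool :=
  (h + #|V| == #|E| + 1 + \sum_v gen G v)%N.

Definition stable h G : bool :=
  [&& (0 < #|V|)%N, conn G setT, has_genus h G & vstable G].

End GraphData.

Section Iso.
Context {b b' : nat} {V V' E E' L L' : finType}.

(** Two isomorphic graphs may have different bounds on the genera of their vertices,
    and q may exchange the two halves of an edge. *)
Record iso (G : graph b V E L) (G' : graph b' V' E' L')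
    (p : V -> V') (q : E * bool -> E' * bool) (l : L -> L') : Prop := Iso {
  iso_p : bijective p;
  iso_q : bijective q;
  iso_l : bijective l;
  iso_flip : forall x, q (flip x) = flip (q x);
  iso_vtx : forall x, vtx G' (q x) = p (vtx G x);
  iso_gen : forall v, gen G' (p v) = gen G v :> nat;
  iso_leg : forall i, leg G' (l i) = p (leg G i) }.
End Iso.

Section IsoTheory.
Context {b b' : nat} {V V' E E' L L' : finType}.
Context {G : graph b V E L} {G' : graph b' V' E' L'}.
Context {p : V -> V'} {q : E * bool -> E' * bool} {l : L -> L'}.

Lemma iso_sym : iso G G' p q l -> exists p' q' l',
  [/\ iso G' G p' q' l', cancel p p' /\ cancel p' p,
      cancel q q' /\ cancel q' q & cancel l l' /\ cancel l' l].
Proof.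
case=> [[p' pK p'K]] [q' qK q'K] [l' lK l'K] qf qv pg lg.
exists p', q', l'; split=> //; split; try by [exists p|exists q|exists l].
- by move=> x; rewrite -{1}(q'K x) -qf qK.
- by move=> x; rewrite -{2}(q'K x) qv pK.
- by move=> v; rewrite -{2}(p'K v) pg.
- by move=> i; rewrite -{2}(l'K i) lg pK.
Qed.

Hypothesis GG' : iso G G' p q l.

Lemma iso_edge_flip x : (q (flip x)).1 = (q x).1.
Proof. by rewrite (iso_flip GG'). Qed.

Lemma iso_edgeE e c : (q (e, c)).1 = (q (e, false)).1.
Proof. by case: c => //; rewrite -iso_edge_flip. Qed.

Lemma iso_edge_bij : bijective (fun e => (q (e, false)).1).
Proof.
have [p' [q' [l' [G'G _ [qK q'K] _]]]] := iso_sym GG'.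
have q'E e c : (q' (e, c)).1 = (q' (e, false)).1.
  by case: c => //; rewrite -[(e, true)]/(flip (e, false)) (iso_flip G'G).
exists (fun e => (q' (e, false)).1) => e.
  by rewrite -(q'E _ (q (e, false)).2) -surjective_pairing qK.
by rewrite -(iso_edgeE _ (q' (e, false)).2) -surjective_pairing q'K.
Qed.

Lemma iso_hedges v : q @: hedges G v = hedges G' (p v).
Proof.
have [q' qK q'K] := iso_q GG'; have [p' pK _] := iso_p GG'.
apply/setP=> y; apply/imsetP/idP => [[x]|].
  by rewrite !inE => /eqP xv ->; rewrite (iso_vtx GG') xv.
rewrite inE => /eqP yv; exists (q' y) => //.
by rewrite inE -(can_eq pK) -(iso_vtx GG') q'K yv.
Qed.

Lemma iso_legs v : l @: legs G v = legs G' (p v).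
Proof.
have [l' lK l'K] := iso_l GG'; have [p' pK _] := iso_p GG'.
apply/setP=> y; apply/imsetP/idP => [[x]|].
  by rewrite !inE => /eqP xv ->; rewrite (iso_leg GG') xv.
rewrite inE => /eqP yv; exists (l' y) => //.
by rewrite inE -(can_eq pK) -(iso_leg GG') l'K yv.
Qed.

Lemma iso_card_legs v : #|legs G' (p v)| = #|legs G v|.
Proof. by rewrite -iso_legs card_imset //; apply: bij_inj (iso_l GG'). Qed.

Lemma iso_card_hedges v : #|hedges G' (p v)| = #|hedges G v|.
Proof. by rewrite -iso_hedges card_imset //; apply: bij_inj (iso_q GG'). Qed.

Lemma iso_vstable : vstable G' = vstable G.
Proof.
have [p' pK p'K] := iso_p GG'.
apply/forallP/forallP => h v; have := h.
  by move/(_ (p v)); rewrite (iso_gen GG') iso_card_legs iso_card_hedges.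
move/(_ (p' v)); rewrite -(iso_gen GG') -iso_card_legs -iso_card_hedges.
by rewrite p'K.
Qed.

Lemma iso_has_genus h : has_genus h G' = has_genus h G.
Proof.
have eV : #|V| = #|V'| := bij_eq_card (iso_p GG').
have eE : #|E| = #|E'| := bij_eq_card iso_edge_bij.
rewrite /has_genus eV eE; congr (_ == _ + _ + _)%N.
rewrite (reindex p) /=; last exact: onW_bij (iso_p GG').
by apply: eq_bigr => v _; rewrite (iso_gen GG').
Qed.

End IsoTheory.

Lemma connect_homo (T T' : finType) (e : rel T) (e' : rel T') (f : T -> T') :
  (forall x y, e x y -> connect e' (f x) (f y)) ->
  forall x y, connect e x y -> connect e' (f x) (f y).
Proof.
move=> ee' x y /connectP [s]; elim: s x => [x _ -> //|z s IH x /= /andP [xz zs] ylast].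
exact: connect_trans (ee' _ _ xz) (IH _ zs ylast).
Qed.

Section IsoConnect.
Context {b b' : nat} {V V' E E' L L' : finType}.
Context {G : graph b V E L} {G' : graph b' V' E' L'}.
Context {p : V -> V'} {q : E * bool -> E' * bool} {l : L -> L'}.
Hypothesis GG' : iso G G' p q l.

Lemma iso_connect_sub (S : {set E}) (S' : {set E'}) u v :
  (forall x, x.1 \in S -> (q x).1 \in S') ->
  connect (adj G S) u v -> connect (adj G' S') (p u) (p v).
Proof.
move=> SS'; apply: connect_homo => {}u {}v /existsP [x /and3P [xS /eqP xu /eqP xv]].
apply: connect1; apply/existsP; exists (q x).
by rewrite SS' // (iso_vtx GG') -(iso_flip GG') (iso_vtx GG') xu xv !eqxx.
Qed.
End IsoConnect.

Section IsoInvariance.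
Context {b b' : nat} {V V' E E' L L' : finType}.
Context {G : graph b V E L} {G' : graph b' V' E' L'}.
Context {p : V -> V'} {q : E * bool -> E' * bool} {l : L -> L'}.
Hypothesis GG' : iso G G' p q l.

Lemma iso_connect (S : {set E}) (S' : {set E'}) u v :
  (forall x, ((q x).1 \in S') = (x.1 \in S)) ->
  connect (adj G' S') (p u) (p v) = connect (adj G S) u v.
Proof.
move=> SS'; apply/idP/idP; last by apply: (iso_connect_sub GG') => x; rewrite SS'.
have [p' [q' [l' [G'G [pK _] [qK q'K] _]]]] := iso_sym GG'.
rewrite -{2}(pK u) -{2}(pK v); apply: (iso_connect_sub G'G).
by move=> x; rewrite -SS' q'K.
Qed.

Lemma iso_conn (S : {set E}) (S' : {set E'}) :
  (forall x, ((q x).1 \in S') = (x.1 \in S)) -> conn G' S' = conn G S.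
Proof.
move=> SS'; have [p' pK p'K] := iso_p GG'.
apply/forallP/forallP => h u; apply/forallP => v.
  by rewrite -(iso_connect _ _ SS') (forallP (h _)).
by rewrite -(p'K u) -(p'K v) (iso_connect _ _ SS') (forallP (h _)).
Qed.

Lemma iso_stable h : stable h G' = stable h G.
Proof.
rewrite /stable (iso_vstable GG') (iso_has_genus GG' h).
by rewrite (bij_eq_card (iso_p GG')) (@iso_conn setT setT) // => x; rewrite !inE.
Qed.
End IsoInvariance.

Lemma iso_trans b b' b'' (V V' V'' E E' E'' L L' L'' : finType)
    (G : graph b V E L) (G' : graph b' V' E' L') (G'' : graph b'' V'' E'' L'')
    p q l p' q' l' :
  iso G G' p q l -> iso G' G'' p' q' l' -> iso G G'' (p' \o p) (q' \o q) (l' \o l).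
Proof.
case=> bp bq bl h1 h2 h3 h4 [bp' bq' bl' h1' h2' h3' h4'].
split; try exact: bij_comp.
- by move=> x; rewrite /= h1 h1'.
- by move=> x; rewrite /= h2' h2.
- by move=> x; rewrite /= h3' h3.
- by move=> x; rewrite /= h4' h4.
Qed.

Section Weight.
Context {K : comPzRingType} (D : nat) (nu : nat -> seq nat -> K).
Hypothesis nu_perm : forall h s t, perm_eq s t -> nu h s = nu h t.

Section Def.
Context {b : nat} {V E L : finType}.
Implicit Type G : graph b V E L.

(** The exponents at v, with exponent 0 at the legs: the value 0 is substituted for
    the variable of a leg in N. *)
Definition decor G (d : {ffun E * bool -> 'I_D.+1}) v : seq nat :=
  [seq nat_of_ord (d x) | x <- enum (hedges G v)] ++ nseq #|legs G v| 0%N.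

(** The value of Z on a graph polynomial, without its constant: expanding the
    product over the vertices amounts to choosing an exponent d at each half-edge,
    then each vertex contributes a coefficient nu of N and Z contributes w at each
    edge. The factor w may depend on the edge, so as to single out one edge. *)
Definition weight (w : E -> nat -> K) G : K :=
  \sum_(d : {ffun E * bool -> 'I_D.+1})
    (\prod_v nu (gen G v) (decor G d v))
    * \prod_e w e (d (e, false) + d (e, true))%N.
End Def.

Lemma iso_weight b b' (V V' E E' L L' : finType)
    (G : graph b V E L) (G' : graph b' V' E' L') p q l w w' :
  iso G G' p q l -> (forall e s, w' (q (e, false)).1 s = w e s) ->
  weight w' G' = weight w G.
Proof.
move=> GG' ww'; have [q' qK q'K] := iso_q GG'.
rewrite /weight (reindex (fun d : {ffun E * bool -> 'I_D.+1} => [ffun y => d (q' y)])) /=; last first.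
  exists (fun d : {ffun E' * bool -> 'I_D.+1} => [ffun x => d (q x)]) => d _;
  by apply/ffunP => x; rewrite !ffunE ?qK ?q'K.
apply: eq_bigr => d _; congr (_ * _).
  rewrite (reindex p) /=; last exact: onW_bij (iso_p GG').
  apply: eq_bigr => v _; rewrite (iso_gen GG'); apply: nu_perm.
  rewrite /decor (iso_card_legs GG') perm_cat2r.
  have /perm_map h : perm_eq (enum (hedges G' (p v))) (map q (enum (hedges G v))).
    apply: uniq_perm; rewrite ?map_inj_uniq ?enum_uniq //; first exact: bij_inj (iso_q GG').
    move=> y; rewrite mem_enum -(iso_hedges GG').
    apply/imsetP/mapP => -[x xv ->]; exists x => //; rewrite ?mem_enum // -mem_enum //.
  apply: perm_trans (h _ _) _; rewrite -map_comp; apply/seq.permP => a.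
  by congr (count a _); apply: eq_map => x /=; rewrite ffunE qK.
rewrite (reindex (fun e => (q (e, false)).1)) /=; last exact: onW_bij (iso_edge_bij GG').
apply: eq_bigr => e _; rewrite !ffunE ww'.
have -> : ((q (e, false)).1, false) = q (e, (q (e, false)).2).
  case E1: (q (e, false)) => [f []] //=.
  by rewrite -[(e, true)]/(flip (e, false)) (iso_flip GG') E1.
have -> : ((q (e, false)).1, true) = q (e, ~~ (q (e, false)).2).
  case E1: (q (e, false)) => [f []] //=.
  by rewrite -[(e, true)]/(flip (e, false)) (iso_flip GG') E1.
by rewrite !qK; case: (_.2) => //=; rewrite addnC.
Qed.

End Weight.

Section Relabel.
Context {b : nat} {V V' E E' L L' : finType}.

(** Transport of structure along bijections is a bijection between the graphs on
    two triples of types. *)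
Lemma sum_relabel (A : nmodType) (p : V -> V') (s : E -> E') (l : L -> L')
    (F : graph b V E L -> A) (F' : graph b V' E' L' -> A) :
  bijective p -> bijective s -> bijective l ->
  (forall G G', iso G G' p (fun x => (s x.1, x.2)) l -> F G = F' G') ->
  \sum_G F G = \sum_G' F' G'.
Proof.
move=> [p' pK p'K] [s' sK s'K] [l' lK l'K] FF'.
pose r (G : graph b V E L) : graph b V' E' L' :=
  ([ffun v => gen G (p' v)], [ffun x => p (vtx G (s' x.1, x.2))],
   [ffun i => p (leg G (l' i))]).
pose r' (G : graph b V' E' L') : graph b V E L :=
  ([ffun v => gen G (p v)], [ffun x => p' (vtx G (s x.1, x.2))],
   [ffun i => p' (leg G (l i))]).
rewrite [RHS](reindex r) /=; last first.
  exists r' => -[[ge ve] le] _; rewrite /r /r' /gen /vtx /leg /=; congr (_, _, _);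
  by apply/ffunP => x; rewrite !ffunE ?pK ?p'K ?lK ?l'K //; case: x => x c /=; rewrite ?sK ?s'K ?pK ?p'K.
apply: eq_bigr => G _; apply: FF'; split; try by [exists p'|exists l'].
- exists (fun x => (s' x.1, x.2)) => -[e c] /=; by rewrite ?sK ?s'K.
- by [].
- by move=> [e c]; rewrite /vtx /= ffunE /= sK.
- by move=> v; rewrite /gen /= ffunE pK.
- by move=> i; rewrite /leg /= ffunE lK.
Qed.
End Relabel.

(** * Spanning trees and cutting an edge *)
Lemma connect_exit (T : finType) (e : rel T) (A : {pred T}) x y :
  connect e x y -> x \in A -> y \notin A ->
  exists u v, [/\ u \in A, v \notin A & e u v].
Proof.
move=> /connectP [s]; elim: s x => [x _ -> /= ->//|z s IH x /= /andP [xz zs] ylast xA yA].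
by have [zA|zA] := boolP (z \in A); [exact: IH zs ylast zA yA | exists x, z].
Qed.

Section Connectivity.
Context {b : nat} {V E L : finType}.
Implicit Types (G : graph b V E L) (S : {set E}).

Lemma adj_sym G S u v : adj G S u v = adj G S v u.
Proof.
apply/existsP/existsP => -[x /and3P [xS xu xv]];
  by exists (flip x); rewrite flipK xS xu xv.
Qed.

Lemma connect_adj_sym G S : connect_sym (adj G S).
Proof. exact: sym_connect_sym (adj_sym G S). Qed.

Lemma conn_from G S u : (forall v, connect (adj G S) u v) -> conn G S.
Proof.
move=> h; apply/forallP=> v; apply/forallP => w.
by apply: connect_trans (h w); rewrite connect_adj_sym.
Qed.

(** A spanning tree is grown one edge at a time. *)
Lemma subtree G v0 j : conn G setT -> (j < #|V|)%N ->
  exists (A : {set V}) (T : {set E}),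
    [/\ v0 \in A, #|A| = j.+1, #|T| = j & forall x, x.1 \in T -> vtx G x \in A].
Proof.
move=> Gconn; elim: j => [_|j IH jV].
  exists [set v0], set0; rewrite set11 cards1 cards0; split=> // x.
  by rewrite in_set0.
have [A [T [v0A cA cT TA]]] := IH (ltnW jV).
have /subsetPn [u _ uA] : ~~ (setT \subset A).
  by apply: contraL jV => /subset_leq_card; rewrite cardsT cA leqNgt.
have /(connect_exit (A := mem A)) := forallP (forallP Gconn v0) u.
case=> // [w [v [wA vA /existsP [x /and3P [_ /eqP xw /eqP xv]]]]].
have xT : x.1 \notin T.
  by apply: contra vA => xT; rewrite -xv; apply: TA.
exists (v |: A), (x.1 |: T); split.
- by rewrite !inE v0A orbT.
- by rewrite cardsU1 vA cA.
- by rewrite cardsU1 xT cT.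
move=> y; rewrite !inE => /orP [/eqP yx|/TA ->]; last by rewrite orbT.
have [->|->] : y = x \/ y = flip x.
  case: (x) (y) yx => [f c] [f' c'] /= ->.
  by case: c c' => [] []; [left|right|right|left].
  by rewrite xw wA orbT.
by rewrite xv eqxx.
Qed.

(** By a spanning tree. This is the inequality that makes genera nonnegative. *)
Lemma conn_card G : conn G setT -> (#|V| <= #|E| + 1)%N.
Proof.
case: (posnP #|V|) => [-> //|V_gt0 Gconn].
have [v0 _] := card_gt0P V_gt0.
have [|A [T [_ _ cT _]]] := @subtree G v0 #|V|.-1 Gconn; first by rewrite prednK.
by have := max_card (mem T); rewrite cT; lia.
Qed.

End Connectivity.

Section Cut.
Context {b : nat} {V L : finType} {m : nat}.

(** The halves of e become two legs, indexed by bool, and the numbering of the other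
    edges closes up. *)
Definition cut (e : 'I_m.+1) (G : graph b V 'I_m.+1 L) :
    graph b V 'I_m (L + bool)%type :=
  (gen G, [ffun x => vtx G (lift e x.1, x.2)],
   [ffun i => match i with inl i => leg G i | inr c => vtx G (e, c) end]).

Definition glue (e : 'I_m.+1) (G : graph b V 'I_m (L + bool)%type) :
    graph b V 'I_m.+1 L :=
  (gen G,
   [ffun x => if unlift e x.1 is Some f then vtx G (f, x.2) else leg G (inr x.2)],
   [ffun i => leg G (inl i)]).

Lemma cutK e : cancel (cut e) (glue e).
Proof.
case=> [[ge ve] le]; rewrite /glue /cut /gen /vtx /leg /=; congr (_, _, _).
  apply/ffunP => -[f c]; rewrite !ffunE /=.
  by case: unliftP => [f' ->|->]; rewrite ?ffunE.
by apply/ffunP => i; rewrite !ffunE.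
Qed.

Lemma glueK e : cancel (glue e) (cut e).
Proof.
case=> [[ge ve] le]; rewrite /glue /cut /gen /vtx /leg /=; congr (_, _, _).
  by apply/ffunP => -[f c]; rewrite !ffunE /= liftK.
by apply/ffunP => -[i|c]; rewrite !ffunE //= unlift_none.
Qed.

Lemma sum_cut (A : nmodType) (F : graph b V 'I_m (L + bool)%type -> A) e :
  \sum_G F (cut e G) = \sum_G F G.
Proof.
by rewrite [RHS](reindex (cut e)) //; exists (glue e) => G _; rewrite ?cutK ?glueK.
Qed.

Lemma halfedge_sum (A : nmodType) (F : 'I_m.+1 * bool -> A) (e : 'I_m.+1) :
  \sum_x F x = \sum_(x : 'I_m * bool) F (lift e x.1, x.2) + \sum_c F (e, c).
Proof.
rewrite (eq_bigr (fun x => F (x.1, x.2))); last by case.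
rewrite -(pair_big predT predT (fun f c => F (f, c))) /=.
rewrite (bigD1_ord e) //= addrC; congr (_ + _).
by rewrite (pair_big predT predT (fun f c => F (lift e f, c))).
Qed.

(** Half-edges at v before the cut are the half-edges after it together with those of
    the two new legs that are at v. *)
Lemma hedges_cut (A : nmodType) (F : 'I_m.+1 * bool -> A) (e : 'I_m.+1)
    (G : graph b V 'I_m.+1 L) v :
  \sum_(x in hedges G v) F x
  = \sum_(x in hedges (cut e G) v) F (lift e x.1, x.2)
    + \sum_(c | inr c \in legs (cut e G) v) F (e, c).
Proof.
rewrite big_mkcond (halfedge_sum _ e) [in RHS]big_mkcond [X in _ = _ + X]big_mkcond.
by congr (_ + _); apply: eq_bigr => x _; rewrite !inE !ffunE.
Qed.

Lemma legs_cut (e : 'I_m.+1) (G : graph b V 'I_m.+1 L) v :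
  #|legs (cut e G) v| = (#|legs G v| + \sum_(c | inr c \in legs (cut e G) v) 1)%N.
Proof.
rewrite -!sum1_card big_mkcond big_sumType /= -!big_mkcond; congr (_ + _)%N.
by apply: eq_bigl => i; rewrite !inE ffunE.
Qed.

Lemma cut_vstable (e : 'I_m.+1) (G : graph b V 'I_m.+1 L) : vstable (cut e G) = vstable G.
Proof.
apply: eq_forallb => v; rewrite legs_cut; congr (_ < _ + _)%N.
by rewrite -!sum1_card (hedges_cut (fun=> 1%N) e) /= addnAC addnA.
Qed.

Lemma cut_conn_del (e : 'I_m.+1) (G : graph b V 'I_m.+1 L) :
  conn G (~: [set e]) = conn (cut e G) setT.
Proof.
suff eadj : adj G (~: [set e]) =2 adj (cut e G) setT.
  by apply: eq_forallb => u; apply: eq_forallb => v; apply: eq_connect.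
move=> u v; apply/existsP/existsP => -[[f c] /and3P [fS fu fv]].
  move: fS; rewrite !inE eq_sym => /unlift_some [f' fE _].
  by exists (f', c); rewrite inE /vtx /= !ffunE /= -fE fu fv.
exists (lift e f, c); rewrite in_setC1 eq_sym neq_lift /=.
by move: fu fv; rewrite /vtx /= !ffunE /= => -> ->.
Qed.

(** The endpoints of the two legs indexed by bool reach every vertex between them. *)
Definition linked (E : finType) (G : graph b V E (L + bool)%type) : bool :=
  [forall v, connect (adj G setT) (leg G (inr false)) v
          || connect (adj G setT) (leg G (inr true)) v].

Lemma cut_connect (e : 'I_m.+1) (G : graph b V 'I_m.+1 L) u v :
  connect (adj (cut e G) setT) u v -> connect (adj G setT) u v.
Proof.
apply: (@connect_homo _ _ _ _ id) => {}u {}v /existsP [[f c] /and3P [_ fu fv]].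
apply: connect1; apply/existsP; exists (lift e f, c).
by move: fu fv; rewrite in_setT /vtx /= !ffunE /= => -> ->.
Qed.

(** If G is connected, the set of the vertices reached from the ends of e without
    using e is left by no edge, hence it contains all vertices. *)
Lemma cut_conn (e : 'I_m.+1) (G : graph b V 'I_m.+1 L) : conn G setT = linked (cut e G).
Proof.
set H := cut e G; have lfE c : leg H (inr c) = vtx G (e, c) by rewrite ffunE.
have lft : connect (adj G setT) (leg H (inr false)) (leg H (inr true)).
  by apply: connect1; apply/existsP; exists (e, false); rewrite !lfE inE !eqxx.
apply/idP/forallP => [Gc v|Hl].
  (* The set A is left by no edge: an edge other than e stays in A, and both ends of e
     are in A. *)
  pose A := [pred v | connect (adj H setT) (leg H (inr false)) v
          || connect (adj H setT) (leg H (inr true)) v].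
  apply/negPn/negP => vA.
  have fA : leg H (inr false) \in A by rewrite inE connect0.
  have tA : leg H (inr true) \in A by rewrite inE connect0 orbT.
  have [u [w [uA wA]]] := connect_exit (forallP (forallP Gc _) v) fA vA.
  case/existsP=> -[f c] /and3P [_ /eqP fu /eqP fw].
  have [f' fE|fE] := unliftP e f; last first.
    move: fw wA; rewrite /flip fE /= => <-.
    by case: (c) => /=; rewrite -lfE ?fA ?tA.
  have uw : connect (adj H setT) u w.
    by apply: connect1; apply/existsP; exists (f', c); rewrite inE /vtx /= !ffunE -fu -fw fE !eqxx.
  case/negP: wA; move: uA; rewrite !inE.
  by case/orP => h; rewrite (connect_trans h uw) ?orbT.
apply: (@conn_from _ _ _ _ _ _ (leg H (inr false))) => v.
have /orP [/cut_connect //|/cut_connect h] := Hl v.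
exact: connect_trans lft h.
Qed.

End Cut.

Section WeightCut.
Context {K : comPzRingType} (D : nat) (nu : nat -> seq nat -> K).
Hypothesis nu_perm : forall h s t, perm_eq s t -> nu h s = nu h t.
Context {b : nat} {V L : finType} {m : nat}.

Lemma count_decor b' (V' E' L' : finType) (G : graph b' V' E' L')
    (d : {ffun E' * bool -> 'I_D.+1}) v a :
  count a (decor G d v)
  = (\sum_(x in hedges G v) a (d x) + a 0%N * #|legs G v|)%N.
Proof.
rewrite count_cat count_nseq; congr (_ + _)%N.
by rewrite count_map -sum1_count big_mkcond /= big_enum /=; apply: eq_bigr => x _; case: (a _).
Qed.

(** The weight z [s = 0] on the edge e leaves only the exponents that vanish
    on both halves of e, and these halves then count as legs. *)
Lemma weight_cut (e : 'I_m.+1) (G : graph b V 'I_m.+1 L) (w : nat -> K) z :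
  weight D nu (fun f s => if f == e then (if s == 0%N then z else 0) else w s) G
  = z * weight D nu (fun _ => w) (cut e G).
Proof.
rewrite /weight (bigID (fun d : {ffun 'I_m.+1 * bool -> 'I_D.+1} => (d (e, false) + d (e, true) == 0)%N)) /=.
rewrite [X in _ + X]big1 ?addr0; last first.
  by move=> d /negPf d0; rewrite (bigD1 e) //= eqxx d0 mul0r mulr0.
rewrite big_distrr /=.
pose ext (d : {ffun 'I_m * bool -> 'I_D.+1}) : {ffun 'I_m.+1 * bool -> 'I_D.+1} :=
  [ffun x => if unlift e x.1 is Some f then d (f, x.2) else ord0].
rewrite (reindex_onto ext (fun d => [ffun x => d (lift e x.1, x.2)])) /=; last first.
  move=> d d0; apply/ffunP => -[f c]; rewrite !ffunE /=.
  case: unliftP => [f' ->|->]; rewrite ?ffunE //.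
  by apply/val_inj => /=; move: d0; rewrite addn_eq0 => /andP [/eqP d0 /eqP d1]; case: c.
apply: eq_big => [d|d _].
  rewrite !ffunE /= unlift_none /=.
  by apply/eqP/ffunP => -[f c]; rewrite !ffunE /= liftK.
rewrite [X in _ * X = _](bigD1_ord e) //= eqxx !ffunE /= unlift_none /=.
rewrite mulrCA; congr (_ * (_ * _)); last first.
  by apply: eq_bigr => f _; rewrite eq_sym (negPf (neq_lift _ _)) !ffunE /= liftK.
apply: eq_bigr => v _; apply: nu_perm; apply/seq.permP => a.
rewrite !count_decor (hedges_cut _ e) /= legs_cut mulnDr -addnA; congr (_ + _)%N.
  by apply: eq_bigr => -[f c] _; rewrite ffunE /= liftK.
rewrite addnC; congr (_ + _)%N; rewrite big_distrr /=; apply: eq_bigr => c _.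
by rewrite ffunE /= unlift_none muln1.
Qed.

End WeightCut.

(** * Graphs with two components *)
Definition is_inl (S T : Type) (x : S + T) : bool :=
  if x is inl _ then true else false.

Lemma bij_of_card (T T' : finType) : #|T| = #|T'| -> exists f : T -> T', bijective f.
Proof.
move=> c; exists (fun x => enum_val (cast_ord c (enum_rank x))).
apply: inj_card_bij; last by rewrite c.
by move=> x y /enum_val_inj /cast_ord_inj /enum_rank_inj.
Qed.

Lemma bij_split_set (T : finType) (A : {set T}) :
  exists2 f : T -> 'I_#|A| + 'I_#|~: A|, bijective f & forall x, is_inl (f x) = (x \in A).
Proof.
pose s := enum A ++ enum (~: A).
have sP x : x \in s by rewrite mem_cat !mem_enum inE orbN.
have szs : size s = (#|A| + #|~: A|)%N by rewrite size_cat -!cardE.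
have si x : (index x s < #|A| + #|~: A|)%N by rewrite -szs index_mem.
exists (fun x => split (Ordinal (si x))).
  apply: inj_card_bij; last by rewrite card_sum !card_ord cardsC.
  move=> x y /(can_inj splitK) [] xy.
  by rewrite -(nth_index x (sP x)) xy nth_index.
move=> x; case: splitP => j /= jE.
  have := ltn_ord j; rewrite -jE /s index_cat mem_enum; case: ifP => // _.
  by rewrite [in X in (_ < X)%N]cardE ltnNge leq_addr.
by move: jE; rewrite /s index_cat mem_enum; case: ifP => // xA;
  have := index_mem x (enum A); rewrite mem_enum xA -cardE => /[swap] ->; rewrite ltnNge leq_addr.
Qed.

Section Split.
Context {b : nat} {V E L : finType}.
Implicit Types (G : graph b V E (L + bool)%type) (t : {set V} * {set E} * {set L}).

(** The triple t is a distribution of the vertices, the edges and the legs over two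
    sides such that no edge or leg straddles them; the first of the two extra legs is
    on the side t and the second on the opposite side. *)
Definition separates t G : bool :=
  [&& leg G (inr false) \in t.1.1, leg G (inr true) \notin t.1.1,
      [forall x, (vtx G x \in t.1.1) == (x.1 \in t.1.2)]
    & [forall i, (leg G (inl i) \in t.1.1) == (i \in t.2)]].

Definition conn_in (A : {set V}) G : bool :=
  [forall (u | u \in A), forall (v | v \in A), connect (adj G setT) u v].

Definition components t G : bool :=
  [&& separates t G, conn_in t.1.1 G & conn_in (~: t.1.1) G].

(** The component of the first extra leg. *)
Definition side G : {set V} * {set E} * {set L} :=
  let A := [set v | connect (adj G setT) (leg G (inr false)) v] in
  (A, [set e | vtx G (e, false) \in A], [set i | leg G (inl i) \in A]).

Lemma separates_closed t G u v :
  separates t G -> connect (adj G setT) u v -> (u \in t.1.1) = (v \in t.1.1).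
Proof.
case/and4P=> _ _ /forallP h _; pose e := [rel u v | (u \in t.1.1) == (v \in t.1.1)].
suff h' x y : connect e x y -> e x y.
  move=> uv; apply/eqP/h'; move: uv; apply: (@connect_homo _ _ _ _ id) => {}u {}v.
  case/existsP=> x /and3P [_ /eqP <- /eqP <-]; apply: connect1.
  by rewrite /= (eqP (h x)) (eqP (h (flip x))).
move/connectP=> [s]; elim: s x => [x _ -> /=|z s IH x /= /andP [/eqP -> zs] ylast]; first by rewrite eqxx.
exact: IH.
Qed.

(** A linked disconnected graph has exactly two components, which contain one extra
    leg each. The extra legs tell the components apart, whence t is unique. *)
Lemma componentsE t G :
  components t G = [&& ~~ conn G setT, linked G & t == side G].
Proof.
apply/idP/idP => [/and3P [ts tA tAC]|/and3P [nG lG /eqP ->]]; last first.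
  set lf := leg G (inr false); set lt := leg G (inr true).
  have lfP v : connect (adj G setT) lf v || connect (adj G setT) lt v := forallP lG v.
  have lft : ~~ connect (adj G setT) lf lt.
    apply: contra nG => h; apply: (@conn_from _ _ _ _ _ _ lf) => v.
    by have /orP [//|] := lfP v; apply: connect_trans h.
  have conn2 w u v : connect (adj G setT) w u -> connect (adj G setT) w v ->
      connect (adj G setT) u v.
    by rewrite (connect_adj_sym _ _ w) => h; apply: connect_trans h.
  apply/and3P; split; first (apply/and4P; split => /=).
  - by rewrite inE connect0.
  - by rewrite inE.
  - apply/forallP=> -[e c]; rewrite !inE /=; case: c => //; apply/eqP.
    apply: same_connect_r; first exact: connect_adj_sym.
    by apply: connect1; apply/existsP; exists (e, true); rewrite inE !eqxx.
  - by apply/forallP=> i; rewrite !inE.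
  - apply/'forall_implyP => u; rewrite inE => hu; apply/'forall_implyP => v.
    by rewrite inE; apply: conn2.
  apply/'forall_implyP => u; rewrite !inE => hu; apply/'forall_implyP => v.
  rewrite !inE => hv; have := lfP u; have := lfP v.
  by rewrite (negPf hu) (negPf hv) /= => + h; apply: conn2.
have cl := separates_closed ts; case/and4P: (ts) => lfA ltA /forallP tB /forallP tC.
have AE : t.1.1 = [set v | connect (adj G setT) (leg G (inr false)) v].
  apply/setP=> v; rewrite inE; apply/idP/idP => [vA|/cl <- //].
  by move/'forall_implyP: tA => /(_ _ lfA) /'forall_implyP; apply.
apply/and3P; split.
- apply: contra ltA => /forallP /(_ (leg G (inr false))) /forallP /(_ (leg G (inr true))).
  by move/cl <-.
- apply/forallP=> v; have [vA|vA] := boolP (v \in t.1.1).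
    by move: vA; rewrite AE inE => ->.
  move/'forall_implyP: tAC => /(_ (leg G (inr true))); rewrite inE => /(_ ltA).
  by move/'forall_implyP/(_ v); rewrite inE => /(_ vA) ->; rewrite orbT.
case: (t) AE tB tC => [[A B] C] /= -> tB tC; apply/eqP; congr (_, _, _).
  by apply/setP=> e; rewrite inE (eqP (tB (e, false))).
by apply/setP=> i; rewrite inE (eqP (tC i)).
Qed.

Lemma sum_components (R : nmodType) (P : pred (graph b V E (L + bool)%type)) F :
  \sum_(G | [&& ~~ conn G setT, linked G & P G]) F G
  = \sum_t \sum_(G | components t G && P G) F G :> R.
Proof.
rewrite (exchange_big_dep [pred G | [&& ~~ conn G setT, linked G & P G]]) /=; last first.
  by move=> t G _ /andP []; rewrite componentsE => /and3P [-> ->].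
apply: eq_bigr => G /and3P [nG lG PG].
by rewrite (eq_bigl (pred1 (side G))) ?big_pred1_eq // => t; rewrite componentsE nG lG PG andbT.
Qed.

End Split.

Lemma iso_components b b' (V V' E E' L L' : finType)
  (G : graph b V E (L + bool)%type) (G' : graph b' V' E' (L' + bool)%type)
  (p : V -> V') (s : E -> E') (l : L -> L')
  (t : {set V} * {set E} * {set L}) (t' : {set V'} * {set E'} * {set L'}) :
  iso G G' p (fun x => (s x.1, x.2))
    (fun i => match i with inl i => inl (l i) | inr c => inr c end) ->
  (forall v, (p v \in t'.1.1) = (v \in t.1.1)) ->
  (forall e, (s e \in t'.1.2) = (e \in t.1.2)) ->
  (forall i, (l i \in t'.2) = (i \in t.2)) ->
  bijective s -> bijective l ->
  components t' G' = components t G.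
Proof.
move=> GG' pt st lt [s' sK s'K] [l' lK l'K]; have [p' pK p'K] := iso_p GG'.
have legc c : leg G' (inr c) = p (leg G (inr c)) by rewrite -(iso_leg GG').
have ccE (A : {set V}) (A' : {set V'}) : (forall v, (p v \in A') = (v \in A)) ->
    conn_in A' G' = conn_in A G.
  move=> AA'; apply/'forall_implyP/'forall_implyP => h u uA; apply/'forall_implyP => v vA.
    have /'forall_implyP /(_ (p v)) := h (p u) ltac:(by rewrite AA').
    by rewrite AA' (iso_connect GG' (S := setT)) => [/(_ vA)//|x]; rewrite !inE.
  rewrite -(p'K u) -(p'K v) (iso_connect GG' (S := setT)) => [|x]; last by rewrite !inE.
  have /'forall_implyP := h (p' u) ltac:(by rewrite -AA' p'K).
  by apply; rewrite -AA' p'K.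
rewrite /components (ccE t.1.1) // (ccE (~: t.1.1)) => [|v]; last by rewrite !inE pt.
congr (_ && _); rewrite /separates !legc !pt; congr [&& _, _, _ & _].
  apply/forallP/forallP => h [e c]; first by have := h (s e, c); rewrite (iso_vtx GG' (e, c)) pt /= st.
  rewrite -(s'K e); have := iso_vtx GG' (s' e, c) => /= ->; rewrite pt /= s'K.
  by have := h (s' e, c); rewrite /= -st s'K.
apply/forallP/forallP => h i; first by have := h (l i); rewrite (iso_leg GG' (inl i)) pt lt.
by rewrite -(l'K i) (iso_leg GG' (inl (l' i))) pt lt.
Qed.

(** * Joining two graphs *)
Section Join.
Context {b : nat} {V1 V2 E1 E2 L1 L2 : finType}.
Local Notation V := (V1 + V2)%type.
Local Notation E := (E1 + E2)%type.
Local Notation L := (L1 + L2)%type.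
Local Notation graph1 := (graph b V1 E1 (L1 + unit)%type).
Local Notation graph2 := (graph b V2 E2 (L2 + unit)%type).

(** Each of the two graphs has a leg of index tt, which stands for its half of the
    edge that was cut; in the result these are the extra legs. *)
Definition join (G1 : graph1) (G2 : graph2) : graph b V E (L + bool)%type :=
  ([ffun v => match v with inl v => gen G1 v | inr v => gen G2 v end],
   [ffun x => match x.1 with inl e => inl (vtx G1 (e, x.2))
                           | inr e => inr (vtx G2 (e, x.2)) end],
   [ffun i => match i with
      | inl (inl i) => inl (leg G1 (inl i))
      | inl (inr i) => inr (leg G2 (inl i))
      | inr false => inl (leg G1 (inr tt))
      | inr true => inr (leg G2 (inr tt))
      end]).

(** For a disjoint union of types the distribution over two sides is fixed; other
    distributions reduce to this one by relabelling. *)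
Definition left_side : {set V} * {set E} * {set L} :=
  ([set v | is_inl v], [set e | is_inl e], [set i | is_inl i]).

Lemma join_inj : injective (fun G12 : graph1 * graph2 => join G12.1 G12.2).
Proof.
move=> [[[g1 v1] l1] [[g2 v2] l2]] [[[g1' v1'] l1'] [[g2' v2'] l2']] /= [].
move=> /ffunP eg /ffunP ev /ffunP el; congr (_, _, _, (_, _, _)); apply/ffunP.
- by move=> v; have := eg (inl v); rewrite !ffunE.
- by move=> [e c]; have := ev (inl e, c); rewrite !ffunE => -[].
- case=> [i|[]]; first by have := el (inl (inl i)); rewrite !ffunE => -[].
  by have := el (inr false); rewrite !ffunE => -[].
- by move=> v; have := eg (inr v); rewrite !ffunE.
- by move=> [e c]; have := ev (inr e, c); rewrite !ffunE => -[].
- case=> [i|[]]; first by have := el (inl (inr i)); rewrite !ffunE => -[].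
  by have := el (inr true); rewrite !ffunE => -[].
Qed.

Lemma separates_joinP (G : graph b V E (L + bool)%type) :
  reflect (exists (G1 : graph1) (G2 : graph2), G = join G1 G2) (separates left_side G).
Proof.
apply: (iffP and4P) => [[]|[G1 [G2 ->]]]; last first.
  rewrite !inE !ffunE /=; split=> //.
    by apply/forallP => -[[e|e] c]; rewrite !inE ffunE.
  by apply/forallP => -[i|i]; rewrite !inE ffunE.
rewrite !inE /=; case lfE: (leg G (inr false)) => [f|//] _.
case ltE: (leg G (inr true)) => [//|t] _ /forallP vG /forallP lG.
pose fl (v : V) := if v is inl v then v else f.
pose fr (v : V) := if v is inr v then v else t.
have flK v : is_inl v -> inl (fl v) = v by case: v.
have frK v : ~~ is_inl v -> inr (fr v) = v by case: v.
exists ([ffun v => gen G (inl v)], [ffun x => fl (vtx G (inl x.1, x.2))],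
  [ffun i => match i with inl i => fl (leg G (inl (inl i))) | inr _ => f end]).
exists ([ffun v => gen G (inr v)], [ffun x => fr (vtx G (inr x.1, x.2))],
  [ffun i => match i with inl i => fr (leg G (inl (inr i))) | inr _ => t end]).
case: G lfE ltE vG lG => [[ge ve] le]; rewrite /join /gen /vtx /leg /= => lfE ltE vG lG.
congr (_, _, _); apply/ffunP.
- by case=> v; rewrite !ffunE.
- case=> -[e|e] c; rewrite !ffunE /= ?ffunE /=.
    by rewrite flK //; have := vG (inl e, c); rewrite !inE => /eqP ->.
  by rewrite frK //; have := vG (inr e, c); rewrite !inE => /eqP ->.
- case=> [[i|i]|[]]; rewrite !ffunE //= ?ffunE //=.
    by rewrite flK //; have := lG (inl i); rewrite !inE => /eqP ->.
  by rewrite frK //; have := lG (inr i); rewrite !inE => /eqP ->.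
Qed.

Lemma sum_halfedges_join (A : nmodType) (F : E * bool -> A) :
  \sum_x F x = \sum_(x : E1 * bool) F (inl x.1, x.2) + \sum_(x : E2 * bool) F (inr x.1, x.2).
Proof.
rewrite (eq_bigr (fun x => F (x.1, x.2))); last by case.
rewrite -(pair_big predT predT (fun e c => F (e, c))) /= big_sumType /=; congr (_ + _).
  by rewrite (pair_big predT predT (fun e c => F (inl e, c))).
by rewrite (pair_big predT predT (fun e c => F (inr e, c))).
Qed.

Lemma hedges_joinl (A : nmodType) (F : E * bool -> A) (G1 : graph1) (G2 : graph2) v :
  \sum_(x in hedges (join G1 G2) (inl v)) F x = \sum_(x in hedges G1 v) F (inl x.1, x.2).
Proof.
rewrite big_mkcond sum_halfedges_join [X in _ + X]big1 ?addr0 => [|x _]; last by rewrite inE ffunE.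
by rewrite [RHS]big_mkcond; apply: eq_bigr => -[e c] _; rewrite !inE ffunE.
Qed.

Lemma hedges_joinr (A : nmodType) (F : E * bool -> A) (G1 : graph1) (G2 : graph2) v :
  \sum_(x in hedges (join G1 G2) (inr v)) F x = \sum_(x in hedges G2 v) F (inr x.1, x.2).
Proof.
rewrite big_mkcond sum_halfedges_join [X in X + _]big1 ?add0r => [|x _]; last by rewrite inE ffunE.
by rewrite [RHS]big_mkcond; apply: eq_bigr => -[e c] _; rewrite !inE ffunE.
Qed.

Lemma legs_joinl (G1 : graph1) (G2 : graph2) v : #|legs (join G1 G2) (inl v)| = #|legs G1 v|.
Proof.
rewrite -!sum1_card big_mkcond [RHS]big_mkcond !big_sumType /= [X in (_ + X + _)%N]big1 => [|i _];
  last by rewrite inE ffunE.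
rewrite addn0; congr (_ + _)%N; first by apply: eq_bigr => i _; rewrite !inE ffunE.
rewrite big_bool /= !inE !ffunE /= add0n.
by rewrite (big_pred1 tt) ?inE //; case.
Qed.

Lemma legs_joinr (G1 : graph1) (G2 : graph2) v : #|legs (join G1 G2) (inr v)| = #|legs G2 v|.
Proof.
rewrite -!sum1_card big_mkcond [RHS]big_mkcond !big_sumType /= [X in (X + _ + _)%N]big1 => [|i _];
  last by rewrite inE ffunE.
rewrite add0n; congr (_ + _)%N; first by apply: eq_bigr => i _; rewrite !inE ffunE.
rewrite big_bool /= !inE !ffunE /= addn0.
by rewrite (big_pred1 tt) ?inE //; case.
Qed.

Lemma join_vstable (G1 : graph1) (G2 : graph2) : vstable (join G1 G2) = vstable G1 && vstable G2.
Proof.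
apply/forallP/andP => [h|[/forallP h1 /forallP h2] [v|v]].
- split; apply/forallP => v; [have := h (inl v) | have := h (inr v)]; rewrite ffunE.
    by rewrite legs_joinl -!sum1_card hedges_joinl.
  by rewrite legs_joinr -!sum1_card hedges_joinr.
- by rewrite ffunE legs_joinl -!sum1_card hedges_joinl sum1_card sum1_card; apply: h1.
- by rewrite ffunE legs_joinr -!sum1_card hedges_joinr sum1_card sum1_card; apply: h2.
Qed.

Lemma join_gen (G1 : graph1) (G2 : graph2) :
  (\sum_v gen (join G1 G2) v = \sum_v gen G1 v + \sum_v gen G2 v)%N.
Proof. by rewrite big_sumType; congr (_ + _)%N; apply: eq_bigr => v _; rewrite ffunE. Qed.

Lemma connect_joinl (G1 : graph1) (G2 : graph2) u v :
  connect (adj (join G1 G2) setT) (inl u) (inl v) = connect (adj G1 setT) u v.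
Proof.
apply/idP/idP; last first.
  apply: connect_homo => {}u {}v /existsP [x /and3P [_ /eqP <- /eqP <-]].
  apply: connect1; apply/existsP; exists (inl x.1, x.2).
  by rewrite inE !ffunE /= -surjective_pairing !eqxx.
pose f (w : V) := if w is inl w then w else u.
pose e' := [rel x y : V | is_inl x ==> (is_inl y && (connect (adj G1 setT) (f x) (f y)))].
suff h x y : connect (adj (join G1 G2) setT) x y -> e' x y by move=> /h.
case/connectP=> s; elim: s x => [x _ -> /=|z s IH x /= /andP [/existsP [[e c]] ]].
  by case: (is_inl x); rewrite //= connect0.
case/and3P=> _ /eqP xE /eqP zE zs ylast; have := IH _ zs ylast.
move: xE zE; rewrite !ffunE /=; case: e => e <- <- //= /andP [-> h].
apply: connect_trans h; apply: connect1; apply/existsP; exists (e, c).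
by rewrite inE !eqxx.
Qed.

Lemma connect_joinr (G1 : graph1) (G2 : graph2) u v :
  connect (adj (join G1 G2) setT) (inr u) (inr v) = connect (adj G2 setT) u v.
Proof.
apply/idP/idP; last first.
  apply: connect_homo => {}u {}v /existsP [x /and3P [_ /eqP <- /eqP <-]].
  apply: connect1; apply/existsP; exists (inr x.1, x.2).
  by rewrite inE !ffunE /= -surjective_pairing !eqxx.
pose f (w : V) := if w is inr w then w else u.
pose e' := [rel x y : V | ~~ is_inl x ==> (~~ is_inl y && (connect (adj G2 setT) (f x) (f y)))].
suff h x y : connect (adj (join G1 G2) setT) x y -> e' x y by move=> /h.
case/connectP=> s; elim: s x => [x _ -> /=|z s IH x /= /andP [/existsP [[e c]] ]].
  by case: (is_inl x); rewrite //= connect0.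
case/and3P=> _ /eqP xE /eqP zE zs ylast; have := IH _ zs ylast.
move: xE zE; rewrite !ffunE /=; case: e => e <- <- //= /andP [-> h].
apply: connect_trans h; apply: connect1; apply/existsP; exists (e, c).
by rewrite inE !eqxx.
Qed.

Lemma components_join (G1 : graph1) (G2 : graph2) :
  components left_side (join G1 G2) = conn G1 setT && conn G2 setT.
Proof.
rewrite /components (introT (separates_joinP _)) /=; last by exists G1, G2.
congr (_ && _).
  apply/'forall_implyP/forallP => [h u|h [u|u]]; rewrite ?inE //.
    apply/forallP => v; rewrite -(connect_joinl G1 G2).
    by have /'forall_implyP := h (inl u) ltac:(by rewrite inE); apply; rewrite inE.
  move=> _; apply/'forall_implyP => -[v|v]; rewrite inE // connect_joinl => _.
  exact: (forallP (h u)).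
apply/'forall_implyP/forallP => [h u|h [u|u]]; rewrite ?inE //.
  apply/forallP => v; rewrite -(connect_joinr G1 G2).
  by have /'forall_implyP := h (inr u) ltac:(by rewrite !inE); apply; rewrite !inE.
move=> _; apply/'forall_implyP => -[v|v]; rewrite !inE // connect_joinr => _.
exact: (forallP (h u)).
Qed.

Lemma sum_join (A : nmodType) (P : pred (graph b V E (L + bool)%type)) F :
  (forall G, P G -> separates left_side G) ->
  \sum_(G | P G) F G
  = \sum_(G12 : graph1 * graph2 | P (join G12.1 G12.2)) F (join G12.1 G12.2) :> A.
Proof.
move=> PS; pose h (G12 : graph1 * graph2) := join G12.1 G12.2.
rewrite [LHS](eq_bigl (fun G => (G \in h @: setT) && P G)); last first.
  move=> G; case: (boolP (P G)) => [/PS/separates_joinP [G1 [G2 GE]]|_]; last by rewrite andbF.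
  by rewrite andbT; symmetry; apply/imsetP; exists (G1, G2).
rewrite big_mkcondr big_imset /=; last by move=> x y _ _ /join_inj.
rewrite [RHS]big_mkcond; apply: eq_bigl => x; by rewrite inE.
Qed.

End Join.

Section WeightJoin.
Context {K : comPzRingType} (D : nat) (nu : nat -> seq nat -> K) (w : nat -> K).
Hypothesis nu_perm : forall h s t, perm_eq s t -> nu h s = nu h t.

Local Notation W G := (weight D nu (fun _ => w) G).

(** A decoration of the disjoint union is a pair of decorations. *)
Lemma weight_join b (V1 V2 E1 E2 L1 L2 : finType)
    (G1 : graph b V1 E1 (L1 + unit)%type) (G2 : graph b V2 E2 (L2 + unit)%type) :
  W (join G1 G2) = W G1 * W G2.
Proof.
rewrite /weight big_distrlr /= pair_big /=.
pose f (d : {ffun E1 * bool -> 'I_D.+1} * {ffun E2 * bool -> 'I_D.+1}) :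
    {ffun (E1 + E2) * bool -> 'I_D.+1} :=
  [ffun x => match x.1 with inl e => d.1 (e, x.2) | inr e => d.2 (e, x.2) end].
rewrite (reindex f) /=; last first.
  exists (fun d => ([ffun x => d (inl x.1, x.2)], [ffun x => d (inr x.1, x.2)])) => d _.
    by case: d => d1 d2; congr (_, _); apply/ffunP => -[e c]; rewrite /f !ffunE /= ?ffunE.
  by apply/ffunP => -[[e|e] c]; rewrite /f !ffunE /= ?ffunE.
apply: eq_bigr => -[d1 d2] _ /=; rewrite mulrACA !big_sumType /=.
congr (_ * _ * (_ * _)); apply: eq_bigr => x _; rewrite !ffunE //=.
  apply: nu_perm; apply/seq.permP => a; rewrite !count_decor hedges_joinl legs_joinl.
  by congr (_ + _)%N; apply: eq_bigr => -[e c] _; rewrite ffunE.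
apply: nu_perm; apply/seq.permP => a; rewrite !count_decor hedges_joinr legs_joinr.
by congr (_ + _)%N; apply: eq_bigr => -[e c] _; rewrite ffunE.
Qed.

Definition stable_sum (b h : nat) (V E L : finType) : K :=
  \sum_(G : graph b V E L | stable h G) W G.

Lemma stable_sum_card b h (V V' E E' L L' : finType) :
  #|V| = #|V'| -> #|E| = #|E'| -> #|L| = #|L'| ->
  stable_sum b h V E L = stable_sum b h V' E' L'.
Proof.
move=> /bij_of_card [p p_bij] /bij_of_card [s s_bij] /bij_of_card [l l_bij].
rewrite /stable_sum !(big_mkcond (stable h)); apply: (sum_relabel p_bij s_bij l_bij) => G G' GG'.
by rewrite (iso_stable GG') (iso_weight D nu_perm GG' (w := fun=> w) (w' := fun=> w)).
Qed.

(** The genera of the two sides are determined by the numbers of vertices and edges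
    and by the genera of the vertices, and connectedness makes them nonnegative, so
    that exactly one pair (h1, h2) contributes to each pair of graphs. *)
Lemma sum_join_stable b (V1 V2 E1 E2 L1 L2 : finType) :
  \sum_(G : graph b (V1 + V2)%type (E1 + E2)%type (L1 + L2 + bool)%type |
      [&& components left_side G, (b + #|{: V1 + V2}| == #|{: E1 + E2}| + 2 + \sum_v gen G v)%N
        & vstable G]) W G
  = \sum_(h1 < b.+1) \sum_(h2 < b.+1 | (h1 + h2 == b)%N)
      stable_sum b h1 V1 E1 (L1 + unit)%type * stable_sum b h2 V2 E2 (L2 + unit)%type.
Proof.
rewrite sum_join /=; last by move=> G /andP [/andP []].
transitivity (\sum_(h1 < b.+1) \sum_(h2 < b.+1 | (h1 + h2 == b)%N)
  \sum_(G12 : graph b V1 E1 (L1 + unit)%type * graph b V2 E2 (L2 + unit)%type)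
     if stable h1 G12.1 && stable h2 G12.2 then W G12.1 * W G12.2 else 0); last first.
  apply: eq_bigr => h1 _; apply: eq_bigr => h2 _.
  by rewrite -big_mkcond /stable_sum big_distrlr /= pair_big.
rewrite [LHS]big_mkcond; under [RHS]eq_bigr do rewrite exchange_big; rewrite [RHS]exchange_big /=.
apply: eq_bigr => -[G1 G2] _ /=; rewrite components_join join_vstable join_gen weight_join.
have V1_gt0 : (0 < #|V1|)%N by apply/card_gt0P; exists (leg G1 (inr tt)).
have V2_gt0 : (0 < #|V2|)%N by apply/card_gt0P; exists (leg G2 (inr tt)).
have cV : #|{: V1 + V2}| = (#|V1| + #|V2|)%N := card_sum V1 V2.
have cE : #|{: E1 + E2}| = (#|E1| + #|E2|)%N := card_sum E1 E2.
rewrite /stable V1_gt0 V2_gt0 /has_genus cV cE.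
have c1 := @conn_card _ _ _ _ G1; have c2 := @conn_card _ _ _ _ G2.
set v1 := #|V1| in c1 *; set v2 := #|V2| in c2 *; set e1 := #|E1| in c1 *; set e2 := #|E2| in c2 *.
clearbody v1 v2 e1 e2.
case: (boolP (conn G1 setT)) => [/c1 {}c1|_]; last by rewrite [RHS]big1 // => h1 _; rewrite [LHS]big1.
case: (boolP (conn G2 setT)) => [/c2 {}c2|_]; last first.
  by rewrite [RHS]big1 // => h1 _; rewrite [LHS]big1 // => h2 _; rewrite andbF.
case: (vstable G1); last by rewrite !andbF [RHS]big1 // => h1 _; rewrite [LHS]big1 // => h2 _; rewrite andbF.
case: (vstable G2); last by rewrite !andbF [RHS]big1 // => h1 _; rewrite [LHS]big1 // => h2 _; rewrite !andbF.
rewrite !andbT /=; set s1 := (\sum_v gen G1 v)%N; set s2 := (\sum_v gen G2 v)%N; clearbody s1 s2.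
have [e|ne] := eqVneq.
  have b1 : (e1 + 1 + s1 - v1 < b.+1)%N by lia.
  have b2 : (e2 + 1 + s2 - v2 < b.+1)%N by lia.
  rewrite (bigD1 (Ordinal b1)) //= (bigD1 (Ordinal b2)) /=; last by apply/eqP; lia.
  rewrite ifT; last by apply/andP; split; apply/eqP; lia.
  rewrite big1 ?addr0 => [|h2 /andP [_ h2n]]; last first.
    rewrite ifF //; apply: contraNF h2n => /andP [_ /eqP h2e]; apply/eqP/val_inj => /=; lia.
  rewrite big1 ?addr0 // => h1 h1n; rewrite big1 // => h2 _.
  rewrite ifF //; apply: contraNF h1n => /andP [/eqP h1e _]; apply/eqP/val_inj => /=; lia.
rewrite [RHS]big1 // => h1 _; rewrite [LHS]big1 // => h2 /eqP h12; rewrite ifF //.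
by apply: contra_neqF ne => /andP [/eqP h1e /eqP h2e]; lia.
Qed.

(** The distribution t of a disconnected graph is summed over first. Given t,
    numbering both parts of V, E and L turns the graph into a disjoint union. *)
Lemma sum_bridged b (V E L : finType) :
  \sum_(G : graph b V E (L + bool)%type |
      [&& ~~ conn G setT, linked G, (b + #|V| == #|E| + 2 + \sum_v gen G v)%N
        & vstable G]) W G
  = \sum_(t : {set V} * {set E} * {set L})
    \sum_(h1 < b.+1) \sum_(h2 < b.+1 | (h1 + h2 == b)%N)
      stable_sum b h1 'I_#|t.1.1| 'I_#|t.1.2| ('I_#|t.2| + unit)%type
      * stable_sum b h2 'I_#|~: t.1.1| 'I_#|~: t.1.2| ('I_#|~: t.2| + unit)%type.
Proof.
rewrite (sum_components (fun G => (b + #|V| == #|E| + 2 + \sum_v gen G v)%N && vstable G)).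
apply: eq_bigr => t _; rewrite -sum_join_stable.
have [p p_bij pt] := bij_split_set t.1.1.
have [s s_bij st] := bij_split_set t.1.2.
have [l l_bij lt] := bij_split_set t.2.
pose l' (i : L + bool) := match i with inl i => inl (l i) | inr c => inr c end.
have l'_bij : bijective l'.
  have [k lK kK] := l_bij.
  exists (fun i : _ + bool => match i with inl i => inl (k i) | inr c => inr c end).
    by case=> //= i; rewrite lK.
  by case=> //= i; rewrite kK.
rewrite big_mkcond [RHS]big_mkcond; apply: (sum_relabel p_bij s_bij l'_bij) => G G' GG'.
rewrite (iso_components (t := t) GG') ?(iso_vstable GG'); try by move=> x; rewrite ?inE ?pt ?st ?lt.
- rewrite -(bij_eq_card p_bij) -(bij_eq_card s_bij) (iso_weight D nu_perm GG' (w := fun=> w) (w' := fun=> w)) //.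
  congr (if [&& _, _ == (_ + _)%N & _] then _ else _).
  rewrite [RHS](reindex p) /=; last exact: onW_bij.
  by apply: eq_bigr => v _; rewrite (iso_gen GG').
- exact: s_bij.
- exact: l_bij.
Qed.

End WeightJoin.

(** * Isomorphism classes of stable graphs *)
(** The two conditions on the genus differ in that one of them uses truncated
    subtraction, which is harmless for connected graphs. *)
Lemma is_stableE g n k m (G : dgraph g n k m) :
  is_stable G = stable g (G : numbered_graph g n k m).
Proof.
rewrite /is_stable /stable /connected_by -!andbA !card_ord.
apply: andb_id2l => k0; rewrite -[X in X && _]/(conn (G : numbered_graph g n k m) setT).
apply: andb_id2l => /conn_card; rewrite !card_ord => km.
congr (_ && _); rewrite /has_genus /betti1 !card_ord /gen /vgenus.
by set S := (\sum_v _)%N; apply/eqP/eqP; lia.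
Qed.

Section IsIso.
Context {g n : nat}.

Lemma is_isoP k m k' m' (G : dgraph g n k m) (G' : dgraph g n k' m')
    (p : {ffun 'I_k -> 'I_k'}) (q : {ffun 'I_m * bool -> 'I_m' * bool}) :
  reflect (iso (G : numbered_graph g n k m) (G' : numbered_graph g n k' m') p q id)
          (is_iso G G' p q).
Proof.
apply: (iffP and5P) => [[/andP [/eqP kk /injectiveP pI] /andP [/eqP mm /injectiveP qI] /forallP h1 /forallP
  h2 /andP [/forallP h3 /forallP h4]]|[bp bq _ h1 h2 h3 h4]].
  split.
  - by apply: inj_card_bij => //; rewrite !card_ord kk.
  - by apply: inj_card_bij => //; rewrite !card_prod !card_ord mm.
  - by exists id.
  - by move=> x; apply/eqP/h1.
  - by move=> x; apply/eqP/h2.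
  - by move=> v; rewrite -[gen G' _]/(vgenus G' _) (eqP (h3 v)).
  - by move=> i; apply/eqP/h4.
have /eqP := bij_eq_card bp; have /eqP := bij_eq_card bq.
rewrite !card_prod !card_ord card_bool eqn_mul2r /= => mm kk.
have /injectiveP ? := bij_inj bp; have /injectiveP ? := bij_inj bq.
split; try by apply/andP.
- by apply/forallP=> x; apply/eqP; apply: h1.
- by apply/forallP=> x; apply/eqP; apply: h2.
apply/andP; split; apply/forallP=> x; apply/eqP; last exact: h4.
exact/val_inj/h3.
Qed.

Lemma isomorphicP k m k' m' (G : dgraph g n k m) (G' : dgraph g n k' m') :
  reflect (exists p q, iso (G : numbered_graph g n k m) (G' : numbered_graph g n k' m') p q id)
          (isomorphic G G').
Proof.
apply: (iffP existsP) => [[p /existsP [q /is_isoP h]]|[p [q h]]]; first by exists p, q.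
exists [ffun x => p x]; apply/existsP; exists [ffun x => q x]; apply/is_isoP.
case: h => bp bq bi h1 h2 h3 h4; split.
- by apply: (eq_bij bp) => x; rewrite ffunE.
- by apply: (eq_bij bq) => x; rewrite ffunE.
- by [].
- by move=> x; rewrite !ffunE.
- by move=> x; rewrite !ffunE.
- by move=> v; rewrite ffunE.
- by move=> v; rewrite ffunE.
Qed.

Lemma isomorphic_refl k m (G : dgraph g n k m) : isomorphic G G.
Proof. by apply/isomorphicP; exists id, id; split=> //; exists id. Qed.

Lemma isomorphic_sym k m k' m' (G : dgraph g n k m) (G' : dgraph g n k' m') :
  isomorphic G G' -> isomorphic G' G.
Proof.
case/isomorphicP=> p [q h]; have [p' [q' [l' [h' _ _ [_ l'K]]]]] := iso_sym h.
apply/isomorphicP; exists p', q'; case: h' => *; split=> //; first by exists id.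
by move=> i; rewrite -{1}[i](l'K i).
Qed.

Lemma isomorphic_trans k m k' m' k'' m'' (G : dgraph g n k m)
    (G' : dgraph g n k' m') (G'' : dgraph g n k'' m'') :
  isomorphic G G' -> isomorphic G' G'' -> isomorphic G G''.
Proof.
case/isomorphicP=> p [q h] /isomorphicP [p' [q' h']].
by apply/isomorphicP; exists (p' \o p), (q' \o q); exact: iso_trans h h'.
Qed.

Lemma isomorphic_stable k m k' m' (G : dgraph g n k m) (G' : dgraph g n k' m') :
  isomorphic G G' -> is_stable G' = is_stable G.
Proof. by case/isomorphicP=> p [q h]; rewrite !is_stableE (iso_stable h). Qed.

(** The group of order k! m! 2^m that acts on numbered graphs by renumbering the
    vertices and the edges and by exchanging the halves of edges. *)
Definition relabellings k m :
    {set {ffun 'I_k -> 'I_k} * {ffun 'I_m * bool -> 'I_m * bool}} :=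
  [set pq : {ffun 'I_k -> 'I_k} * {ffun 'I_m * bool -> 'I_m * bool} |
    [&& injectiveb pq.1, injectiveb pq.2 & [forall x, pq.2 (flip x) == flip (pq.2 x)]]].

Lemma card_relabellings k m : #|relabellings k m| = (k`! * m`! * 2 ^ m)%N.
Proof.
pose f (a : 'S_k * 'S_m * {ffun 'I_m -> bool}) :
    {ffun 'I_k -> 'I_k} * {ffun 'I_m * bool -> 'I_m * bool} :=
  ([ffun v => a.1.1 v], [ffun x => (a.1.2 x.1, a.2 x.1 (+) x.2)]).
have f_inj : injective f.
  move=> [[s t] c] [[s' t'] c'] [] /ffunP es /ffunP et; congr (_, _, _).
  - by apply/permP => v; have := es v; rewrite !ffunE.
  - by apply/permP => v; have := et (v, false); rewrite !ffunE => -[].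
  - by apply/ffunP => v; have := et (v, false); rewrite !ffunE /= !addbF => -[].
have <- : f @: setT = relabellings k m.
  apply/setP=> -[p q]; apply/imsetP/idP => [[[[s t] c] _ -> {p q}]|]; rewrite inE /=.
    apply/and3P; split.
    - by apply/injectiveP => x y; rewrite !ffunE; apply: perm_inj.
    - apply/injectiveP => -[e a] [e' a']; rewrite !ffunE /= => -[] /perm_inj -> /addbI -> //.
    - by apply/forallP => -[e a]; rewrite !ffunE /= /flip /= addbN.
  case/and3P=> /injectiveP pI /injectiveP qI /forallP qf.
  have q1 e a : (q (e, a)).1 = (q (e, false)).1.
    by case: a => //; rewrite -[(e, true)]/(flip (e, false)) (eqP (qf _)).
  have sI : injective (fun e => (q (e, false)).1).
    move=> e e' /= ee'; have : q (e, false) = q (e', false) \/ q (e, false) = q (e', true).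
      rewrite -[(e', true)]/(flip (e', false)) (eqP (qf _)) /flip.
      by case: (q (e, false)) (q (e', false)) ee' => [x []] [y []] /= ->; [left|right|right|left].
    by case=> /qI [].
  exists (perm pI, perm sI, [ffun e => (q (e, false)).2]) => //.
  congr (_, _); apply/ffunP => x; rewrite !ffunE ?permE //.
  case: x => e a /=; rewrite ?permE ?ffunE; case: a; rewrite ?addbF ?addbT.
    by rewrite -[(e, true)]/(flip (e, false)) (eqP (qf _)).
  by case: (q _).
by rewrite card_imset // cardsT !card_prod !card_Sn card_ffun card_bool card_ord.
Qed.

Definition isos k m (G G' : dgraph g n k m) :=
  [set pq : {ffun 'I_k -> 'I_k} * {ffun 'I_m * bool -> 'I_m * bool} | is_iso G G' pq.1 pq.2].

(** Each renumbering is an isomorphism from G to exactly one graph. *)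
Lemma card_isos_sum k m (G : dgraph g n k m) :
  (\sum_G' #|isos G G'|)%N = #|relabellings k m|.
Proof.
under eq_bigr do rewrite -sum1_card.
rewrite (exchange_big_dep (mem (relabellings k m))) /=; last first.
  move=> G' pq _; rewrite !inE => /is_isoP h.
  rewrite (introT (injectiveP _) (bij_inj (iso_p h))) (introT (injectiveP _) (bij_inj (iso_q h))).
  by apply/forallP => x; rewrite (iso_flip h).
rewrite -sum1_card; apply: eq_bigr => -[p q]; rewrite inE => /and3P [/injectiveP pI /injectiveP qI /forallP qf].
have [p' pK p'K] := injF_bij pI; have [q' qK q'K] := injF_bij qI.
pose G0 : dgraph g n k m := ([ffun v => vgenus G (p' v)],
   [ffun x => p (vertex_of G (q' x))], [ffun i => p (leg_vertex G i)]).
rewrite (eq_bigl (pred1 G0)) ?big_pred1_eq // => G'; rewrite inE /=.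
apply/is_isoP/eqP => [h|->].
  have h1 := iso_gen h; have h2 := iso_vtx h; have h3 := iso_leg h.
  case: G' {h} h1 h2 h3 => [[ge ve] le] /= h1 h2 h3; congr (_, _, _).
  - by apply/ffunP => v; rewrite ffunE; apply/val_inj; rewrite -{1}(p'K v); apply: h1.
  - by apply/ffunP => x; rewrite ffunE -{1}(q'K x); apply: h2.
  - by apply/ffunP => i; rewrite ffunE; apply: h3.
split; [by exists p'|by exists q'|by exists id|by move=> x; apply/eqP| | |].
- by move=> x; rewrite /vtx /= ffunE qK.
- by move=> v; rewrite /gen /= ffunE pK.
- by move=> i; rewrite /leg /= ffunE.
Qed.

(** Isomorphisms between isomorphic graphs are a torsor under the automorphisms. *)
Lemma card_isos k m (G G' : dgraph g n k m) :
  #|isos G G'| = (isomorphic G G' * #|graph_automorphisms G|)%N.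
Proof.
case: (boolP (isomorphic G G')) => [/isomorphicP [p [q h]]|nh]; last first.
  apply: eq_card0 => -[p q]; rewrite inE /=; apply: contraNF nh => h.
  by apply/existsP; exists p; apply/existsP; exists q.
have [p' [q' [l' [h' [pK p'K] [qK q'K] [_ l'K]]]]] := iso_sym h.
have {}h' : iso (G' : numbered_graph g n k m) (G : numbered_graph g n k m) p' q' id.
  case: h' => *; split=> //; first by exists id.
  by move=> i; rewrite -{1}[i](l'K i).
pose f (r : {ffun 'I_k -> 'I_k} * {ffun 'I_m * bool -> 'I_m * bool}) :
    {ffun 'I_k -> 'I_k} * {ffun 'I_m * bool -> 'I_m * bool} :=
  ([ffun v => p (r.1 v)], [ffun x => q (r.2 x)]).
have f_inj : injective f.
  move=> [a c] [a' c'] [] /ffunP ea /ffunP ec; congr (_, _); apply/ffunP => x.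
    by apply: (can_inj pK); have := ea x; rewrite !ffunE.
  by apply: (can_inj qK); have := ec x; rewrite !ffunE.
rewrite mul1n -[RHS](card_imset _ f_inj); apply: eq_card => -[a c].
rewrite inE /=; apply/is_isoP/imsetP => [i|[[a' c']]].
  exists ([ffun v => p' (a v)], [ffun x => q' (c x)]); last first.
    by congr (_, _); apply/ffunP => x; rewrite !ffunE /= ?p'K ?q'K.
  rewrite inE; apply/is_isoP; have := iso_trans i h' => -[bp bq bi h1 h2 h3 h4]; split=> //.
  - by apply: (eq_bij bp) => x; rewrite ffunE.
  - by apply: (eq_bij bq) => x; rewrite ffunE.
  - by move=> x; rewrite !ffunE; apply: h1.
  - by move=> x; rewrite !ffunE; apply: h2.
  - by move=> x; rewrite !ffunE; apply: h3.
  - by move=> x; rewrite !ffunE; apply: h4.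
rewrite inE /= => /is_isoP i [-> ->]; have := iso_trans i h => -[bp bq bi h1 h2 h3 h4]; split=> //.
- by apply: (eq_bij bp) => x; rewrite ffunE.
- by apply: (eq_bij bq) => x; rewrite ffunE.
- by move=> x; rewrite !ffunE; apply: h1.
- by move=> x; rewrite !ffunE; apply: h2.
- by move=> x; rewrite !ffunE; apply: h3.
- by move=> x; rewrite !ffunE; apply: h4.
Qed.

Lemma orbit_stabiliser k m (G : dgraph g n k m) :
  (#|[set G' : dgraph g n k m | isomorphic G G']| * #|graph_automorphisms G| = k`! * m`! * 2 ^ m)%N.
Proof.
rewrite -card_relabellings -(card_isos_sum G) (eq_bigr _ (fun G' _ => card_isos G G')).
rewrite -big_distrl /= -sum1_card [in LHS]big_mkcond; congr (_ * _)%N.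
by apply: eq_bigr => G' _; rewrite inE; case: isomorphic.
Qed.

Lemma card_aut_gt0 k m (G : dgraph g n k m) : (0 < #|graph_automorphisms G|)%N.
Proof.
rewrite lt0n; apply/eqP => h; have := orbit_stabiliser G.
rewrite h muln0 => /esym/eqP; rewrite !muln_eq0 expn_eq0 /=.
by rewrite !eqn0Ngt !fact_gt0.
Qed.

End IsIso.

Section StableSum.
Context {R : numFieldType} {M : lmodType R} {g n : nat}.
Variable F : forall k m, dgraph g n k m -> M.
Hypothesis F_iso : forall k m (G G' : dgraph g n k m), isomorphic G G' -> F G' = F G.

Definition any_iso : rel (any_dgraph g n) :=
  [rel G G' : any_dgraph g n | isomorphic (tagged G) (tagged G')].

Lemma any_iso_equiv (D : {pred any_dgraph g n}) :
  {in D & &, equivalence_rel any_iso}.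
Proof.
move=> G G' G'' _ _ _; split; first exact: isomorphic_refl.
move=> h; apply/idP/idP => h'; last exact: isomorphic_trans h h'.
exact: isomorphic_trans (isomorphic_sym h) h'.
Qed.

Lemma card_class (G : any_dgraph g n) :
  #|[set G' | any_iso G G']|
  = #|[set G' : dgraph g n (tag G).1 (tag G).2 | isomorphic (tagged G) G']|.
Proof.
rewrite -(card_imset _ (f := fun G' => Tagged
    (fun km : 'I_(2 * g + n) * 'I_(3 * g + n) => dgraph g n km.1 km.2) (i := tag G) G')); last first.
  by move=> x y /eqP; rewrite eq_Tagged /= => /eqP.
apply: eq_card => G'; apply/idP/imsetP => [|[H + ->]]; last by rewrite !inE.
rewrite inE => h; case: G' h => [km' G'] h.
have kmE : km' = tag G.
  case/isomorphicP: h => p [q h]; have := bij_eq_card (iso_p h).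
  have := bij_eq_card (iso_q h); rewrite !card_prod !card_ord card_bool => /eqP.
  rewrite eqn_mul2r /= => /eqP mm kk; rewrite [tag G]surjective_pairing [LHS]surjective_pairing.
  by congr (_, _); apply/val_inj.
by case: _ / (esym kmE) G' h => G' h; exists G'; rewrite ?inE.
Qed.

(** The class of G has k! m! 2^m / |Aut G| numbered graphs, so that each of them
    gets the weight 1 / (k! m! 2^m). Beyond the bounds on k and m there is no stable
    graph; arbitrary larger bounds are allowed in order to have the same summation
    range for graphs of different genera. *)
Lemma sum_stable_graphs (kb mb : nat) : (2 * g + n <= kb)%N -> (3 * g + n <= mb)%N ->
  \sum_(G in stable_graphs g n)
      (#|graph_automorphisms (tagged G)|%:R^-1 : R) *: F (tagged G)
  = \sum_(k < kb) \sum_(m < mb) ((k`! * m`! * 2 ^ m)%N%:R^-1 : R)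
      *: \sum_(G : dgraph g n k m | is_stable G) F G.
Proof.
move=> kb_ge mb_ge.
pose T k m := \sum_(G : dgraph g n k m | is_stable G) ((k`! * m`! * 2 ^ m)%N%:R^-1 : R) *: F G.
have T0 k m : ~~ ((k < 2 * g + n) && (m < 3 * g + n))%N -> T k m = 0.
  move=> km; rewrite /T big_pred0 // => G; apply: contraNF km => /stable_bounds; lia.
transitivity (\sum_(k < kb) \sum_(m < mb) T k m); last first.
  by apply: eq_bigr => k _; apply: eq_bigr => m _; rewrite /T scaler_sumr.
transitivity (\sum_(k < 2 * g + n) \sum_(m < 3 * g + n) T k m); last first.
  rewrite (big_ord_widen kb (fun k => \sum_(m < 3 * g + n) T k m)) // big_mkcond.
  apply: eq_bigr => k _; case: ifPn => k_lt; last first.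
    by rewrite big1 // => m _; apply: T0; rewrite (negPf k_lt).
  rewrite (big_ord_widen mb (T k)) // big_mkcond; apply: eq_bigr => m _.
  by case: ifPn => // m_lt; symmetry; apply: T0; rewrite (negPf m_lt) andbF.
rewrite pair_big /= /T (sig_big_dep predT
  (fun (km : 'I_(2 * g + n) * 'I_(3 * g + n)) (G : dgraph g n km.1 km.2) => is_stable G)
  (fun (km : 'I_(2 * g + n) * 'I_(3 * g + n)) (G : dgraph g n km.1 km.2) =>
    ((km.1`! * km.2`! * 2 ^ km.2)%N%:R^-1 : R) *: F G)) /=.
rewrite /stable_graphs; set D := [set G | _]; set P := equivalence_partition _ D.
have Deq : {in D & &, equivalence_rel any_iso} by exact: any_iso_equiv.
have partP : partition P D by exact: equivalence_partitionP.
have trX := transversalP partP; set X := transversal P D in trX *.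
have subXD : X \subset D := transversal_sub trX.
rewrite [RHS](eq_bigl (fun G => G \in D)); last by move=> G; rewrite [RHS]inE.
rewrite [RHS](set_partition_big _ partP) /= -(pblock_transversal trX).
rewrite [RHS]big_imset /=; last by move=> x y Xx Xy; exact: (pblock_inj trX Xx Xy).
apply: eq_bigr => G GX; have GD := subsetP subXD _ GX.
rewrite (eq_bigl (fun G' => G' \in [set G' | any_iso G G'])); last first.
  move=> G'; rewrite [RHS]inE; apply/idP/idP => [G'G|h].
    have G'D : G' \in D.
      have [/eqP <- _ _] := and3P partP; rewrite /cover; apply/bigcupP; exists (pblock P G) => //.
      by rewrite pblock_mem //; have [/eqP -> _ _] := and3P partP.
    by rewrite -(pblock_equivalence_partition Deq).
  rewrite (pblock_equivalence_partition Deq) //.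
  by move: GD; rewrite !inE (isomorphic_stable h).
rewrite (eq_bigr (fun=> (((tag G).1`! * (tag G).2`! * 2 ^ (tag G).2)%N%:R^-1 : R) *: F (tagged G))); last first.
  move=> G'; rewrite inE; case: G GX GD => km G _ _; case: G' => km' G' /= h.
  have kmE : km' = km.
    case/isomorphicP: h => p [q h]; have := bij_eq_card (iso_p h).
    have := bij_eq_card (iso_q h); rewrite !card_prod !card_ord card_bool => /eqP.
    rewrite eqn_mul2r /= => /eqP mm kk; rewrite [km]surjective_pairing [LHS]surjective_pairing.
    by congr (_, _); apply/val_inj.
  by case: _ / (esym kmE) G' h => G' /F_iso ->.
rewrite sumr_const card_class -[RHS]scaler_nat [RHS]scalerA; congr (_ *: _).
have := card_aut_gt0 (tagged G); have := orbit_stabiliser (tagged G).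
set a := #|graph_automorphisms _|; set c := #|_| => <- a0.
have := orbit_stabiliser (tagged G); rewrite -/a -/c => e.
have c0 : (0 < c)%N.
  by apply/card_gt0P; exists (tagged G); rewrite inE isomorphic_refl.
by rewrite natrM; field; rewrite !pnatr_eq0 -!lt0n a0 c0.
Qed.

End StableSum.

(** * Sums over labelled stable graphs *)
Lemma sum_sets (M : nmodType) (T : finType) (F : nat -> nat -> M) :
  \sum_(A : {set T}) F #|A| #|~: A| = \sum_(i < #|T|.+1) F i (#|T| - i)%N *+ 'C(#|T|, i).
Proof.
have cA (A : {set T}) : (#|A| < #|T|.+1)%N by rewrite ltnS max_card.
rewrite (partition_big (fun A : {set T} => Ordinal (cA A)) predT) //=.
apply: eq_bigr => i _; rewrite -card_draws -sumr_const; apply: eq_big => A.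
  by rewrite inE -val_eqE.
by move=> /eqP <- /=; rewrite -(cardsC A) addKn.
Qed.

(** Each pair (i, j) occurs once on the left, for k = i + j, as long as k < D; the
    hypothesis discards the other pairs. *)
Lemma sum_convolution (M : nmodType) D (f : nat -> nat -> M) :
  (forall i j, (D <= i + j)%N -> f i j = 0) ->
  \sum_(k < D) \sum_(i < k.+1) f i (k - i)%N = \sum_(i < D) \sum_(j < D) f i j.
Proof.
move=> f0; transitivity (\sum_(k < D) \sum_(i < D) \sum_(j < D | (i + j == k)%N) f i j).
  apply: eq_bigr => k _; rewrite (big_ord_widen D (fun i => f i (k - i)%N)) // big_mkcond.
  apply: eq_bigr => i _; rewrite ltnS; case: leqP => ik.
    have kiD : (k - i < D)%N by have := ltn_ord k; lia.
    rewrite (big_pred1 (Ordinal kiD)) //= => j.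
    by rewrite [RHS]inE -val_eqE /=; apply/eqP/eqP; lia.
  by rewrite big_pred0 // => j; apply/negP => /eqP; lia.
rewrite exchange_big; apply: eq_bigr => i _ /=.
under eq_bigr do rewrite big_mkcond; rewrite exchange_big; apply: eq_bigr => j _ /=.
case: (ltnP (i + j) D) => ijD; last by rewrite f0 // big1 // => k _; case: ifP.
by rewrite -big_mkcond (big_pred1 (Ordinal ijD)).
Qed.

(** With one leg on each side coming from the cut edge, the sides have a + 1 and
    n - a + 1 legs. *)
Lemma sum_leg_splittings (M : nmodType) n (P : nat -> nat -> bool) (f : nat -> nat -> M) :
  \sum_(n1 < n.+3) \sum_(n2 < n.+3 |
      [&& (n1 + n2 == n + 2)%N, (1 <= n1)%N, (1 <= n2)%N & P n1 n2]) f n1 n2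
  = \sum_(a < n.+1) if P a.+1 (n - a).+1 then f a.+1 (n - a).+1 else 0.
Proof.
rewrite big_ord_recl [X in X + _]big_pred0 ?add0r => [|n2]; last by rewrite andbF.
rewrite big_ord_recr /= [X in _ + X]big_pred0 ?addr0 => [|n2]; last first.
  rewrite /= /bump /=; have [->|n2_gt0] := posnP n2; first by rewrite /= ?andbF.
  by rewrite (_ : (_ == _)%N = false) //; apply/negP => /eqP e; lia.
apply: eq_bigr => a _; have a_le : (a <= n)%N by rewrite -ltnS.
have n2_lt : ((n - a).+1 < n.+3)%N by lia.
rewrite /= /bump /= add1n; case: ifPn => aP.
  rewrite (big_pred1 (Ordinal n2_lt)) // => n2; rewrite [RHS]inE -val_eqE /=.
  apply/idP/eqP => [/andP [/eqP e _]|->]; first by lia.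
  by rewrite aP /= andbT; apply/eqP; lia.
rewrite big_pred0 // => n2; apply/negP => /andP [/eqP e /andP [_]].
have -> : nat_of_ord n2 = (n - a).+1 by lia.
by rewrite (negPf aP).
Qed.

Lemma scaled_product (R : comNzRingType) (A : algType R) (c c1 c2 : R) (x1 x2 : A) :
  c *: ((c1 *: x1) * (c2 *: x2)) = (c * (c1 * c2)) *: (x1 * x2).
Proof. by rewrite -scalerAr -scalerAl !scalerA -mulrA [c2 * c1]mulrC. Qed.

Lemma scale_mulrn (R : nzRingType) (V : lmodType R) (c : R) m (v : V) :
  (c *: v) *+ m = (c * m%:R) *: v.
Proof. by rewrite scalerMnl mulr_natr. Qed.

Section LabelledSums.
Context {R : numFieldType} {K : comAlgType R}.
Variables (D : nat) (nu : nat -> seq nat -> K) (w : nat -> K).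
Hypothesis nu_perm : forall h s t, perm_eq s t -> nu h s = nu h t.

Local Notation W G := (weight D nu (fun _ => w) G).
Local Notation stable_sum := (stable_sum D nu w).

(** No vertex of a connected graph has a larger genus than the graph. *)
Lemma stable_sum_genus_bound b h (V E L : finType) : (h <= b)%N ->
  stable_sum b h V E L = stable_sum h h V E L.
Proof.
move=> hb; have hb1 : (h.+1 <= b.+1)%N by [].
pose up (G : graph h V E L) : graph b V E L :=
  ([ffun v => widen_ord hb1 (gen G v)], vtx G, leg G).
pose down (G : graph b V E L) : graph h V E L := ([ffun v => inord (gen G v)], vtx G, leg G).
have upP G : iso (up G) G id id id.
  by split; try exact: (Bijective (g := id)); move=> // v; rewrite /gen ffunE.
rewrite /stable_sum (reindex_onto up down) /=.
  apply: eq_big => [G|G _]; last first.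
    by rewrite -(iso_weight D nu_perm (upP G) (w := fun=> w) (w' := fun=> w)).
  rewrite (iso_stable (upP G)) andb_idr // => _.
  case: G {upP} => [[ge ve] le]; apply/eqP; congr (_, _, _); apply/ffunP => v.
  by rewrite !ffunE; apply/val_inj; rewrite /= inordK.
move=> G /and4P [_ /conn_card c /eqP e _]; case: G c e => [[ge ve] le] c e; congr (_, _, _).
apply/ffunP => v; rewrite !ffunE; apply/val_inj; rewrite /= inordK //.
move: e; rewrite (bigD1 v) // [in gen (ge, ve, le) v]/gen => e; move: c e; simpl; lia.
Qed.

Definition labelled_sum h n k m : K := stable_sum h h 'I_k 'I_m 'I_n.

(** Stability bounds the numbers of vertices and edges. *)
Lemma labelled_sum0 h n k m :
  ~~ ((k + 2 <= 2 * h + n)%N && (m + 3 <= 3 * h + n)%N) || (k == 0)%N ->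
  labelled_sum h n k m = 0.
Proof.
move=> hkm; apply: big1 => G Gs; exfalso; case/orP: hkm => [|/eqP k0].
  by case/negP; apply/andP; apply: (@stable_bounds h n k m G); rewrite is_stableE.
by case/and4P: Gs => + _ _ _; rewrite card_ord k0.
Qed.

(** Each of the m + 1 edges contributes the same sum over graphs with two extra
    legs. A connected graph of genus g becomes, after cutting, either a connected
    graph of genus g - 1 (none if g = 0), with chi = 1, or a disconnected one, with
    chi = 1/2. *)
Lemma sum_cut_stable g (V L : finType) m :
  \sum_(G : graph g V 'I_m.+1 L | stable g G) \sum_(e < m.+1)
     ((if conn G (~: [set e]) then 1 else 2^-1) : R) *: W (cut e G)
  = (m.+1%:R : R) *:
    ((if g is h.+1 then stable_sum g h V 'I_m (L + bool)%type else 0)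
     + (2^-1 : R) *: \sum_(G : graph g V 'I_m (L + bool)%type |
         [&& ~~ conn G setT, linked G, (g + #|V| == #|'I_m| + 2 + \sum_v gen G v)%N
           & vstable G]) W G).
Proof.
rewrite exchange_big /=.
pose P (G : graph g V 'I_m (L + bool)%type) :=
  [&& (0 < #|V|)%N, linked G, (g + #|V| == #|'I_m| + 2 + \sum_v gen G v)%N & vstable G].
pose F (G : graph g V 'I_m (L + bool)%type) :=
  if P G then ((if conn G setT then 1 else 2^-1) : R) *: W G else 0.
transitivity (\sum_(e < m.+1) \sum_(G : graph g V 'I_m.+1 L) F (cut e G)).
  apply: eq_bigr => e _; rewrite big_mkcond; apply: eq_bigr => G _.
  rewrite cut_conn_del /F /P /stable (cut_conn e) cut_vstable /has_genus !card_ord.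
  by rewrite [(m.+1 + 1)%N]addn1 -[m.+2]addn2.
rewrite (eq_bigr (fun=> \sum_G F G)) => [|e _]; last exact: (sum_cut F e).
rewrite sumr_const -scaler_nat; congr (_ *: _); first by rewrite card_ord.
rewrite /F -big_mkcond (bigID (fun G => conn G setT)) /=; congr (_ + _); last first.
  rewrite scaler_sumr; apply: eq_big => G; last by case/andP=> _ /negPf ->.
  rewrite /P andbC (cardD1 (leg G (inr true))) inE /=.
  by case: (conn G setT).
have connlink (G : graph g V 'I_m (L + bool)%type) : conn G setT -> linked G.
  by move=> /forallP h; apply/forallP => v; rewrite (forallP (h _)).
rewrite /P; clear P F; case: g connlink => [|h] connlink.
  rewrite big_pred0 // => G; apply/negP => /andP [/and4P [_ _ /eqP e _] /conn_card c].
  by move: e c; rewrite card_ord; lia.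
rewrite /stable_sum; apply: eq_big => [G|G /andP [_ ->]]; last by rewrite scale1r.
rewrite /stable /has_genus; case: (boolP (conn G setT)) => [/connlink ->|_]; last by rewrite !andbF.
by rewrite andbT /=; congr [&& _, _ & _]; rewrite card_ord; apply/eqP/eqP; lia.
Qed.

Lemma sum_bridged_labelled g k m n :
  \sum_(G : graph g 'I_k 'I_m ('I_n + bool)%type |
         [&& ~~ conn G setT, linked G, (g + #|'I_k| == #|'I_m| + 2 + \sum_v gen G v)%N
           & vstable G]) W G
  = \sum_(h1 < g.+1) \sum_(h2 < g.+1 | (h1 + h2 == g)%N) \sum_(a < n.+1)
      (\sum_(i < k.+1) \sum_(j < m.+1)
        (labelled_sum h1 a.+1 i j * labelled_sum h2 (n - a).+1 (k - i) (m - j))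
          *+ 'C(m, j) *+ 'C(k, i)) *+ 'C(n, a).
Proof.
rewrite (sum_bridged D w nu_perm) /= exchange_big /=; apply: eq_bigr => h1 _.
rewrite exchange_big /=; apply: eq_bigr => h2 h12.
have b1 : (h1 <= g)%N by rewrite -ltnS.
have b2 : (h2 <= g)%N by rewrite -ltnS.
pose F (i i' j j' a a' : nat) := labelled_sum h1 a.+1 i j * labelled_sum h2 a'.+1 i' j'.
transitivity (\sum_(C : {set 'I_n}) \sum_(A : {set 'I_k}) \sum_(B : {set 'I_m})
    F #|A| #|~: A| #|B| #|~: B| #|C| #|~: C|).
  under [RHS]eq_bigr do rewrite pair_big /=.
  rewrite exchange_big pair_big /=; apply: eq_bigr => -[[A B] C] _ /=.
  by congr (_ * _); rewrite stable_sum_genus_bound // /labelled_sum;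
    apply: (stable_sum_card D w nu_perm); rewrite ?card_sum ?card_unit ?card_ord ?addn1.
rewrite (sum_sets _ (fun a a' => \sum_(A : {set 'I_k}) \sum_(B : {set 'I_m})
  F #|A| #|~: A| #|B| #|~: B| a a')) card_ord.
apply: eq_bigr => a _; congr (_ *+ _).
rewrite (sum_sets _ (fun i i' => \sum_(B : {set 'I_m}) F i i' #|B| #|~: B| a (n - a)%N)) card_ord.
apply: eq_bigr => i _; rewrite (sum_sets _ (fun j j' => F i (k - i)%N j j' a (n - a)%N)) card_ord.
by rewrite sumrMnl.
Qed.

(** The factor 2^-(k-1) is the one in P_Gamma, the other one comes from counting
    numbered graphs. *)
Definition omega k m : R := (2 ^+ k.-1)^-1 * (k`! * m`! * 2 ^ m)%N%:R^-1.

Definition total_sum N h n : K :=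
  \sum_(k < N) \sum_(m < N) omega k m *: labelled_sum h n k m.

(** After removing one of m + 1 edges only its two orientations leave a trace. *)
Lemma omegaS k m : m.+1%:R * omega k m.+1 = 2^-1 * omega k m.
Proof.
rewrite /omega factS expnS !natrM !natrX.
by field; rewrite !expf_neq0 ?pnatr_eq0 -?lt0n ?fact_gt0 //= addrC natr1 pnatr_eq0.
Qed.

(** The factor 1/2 appears because (k - 1) + (k' - 1) is one less than k + k' - 1. *)
Lemma omegaD k m k' m' : (0 < k)%N -> (0 < k')%N ->
  'C(m + m', m)%:R * 'C(k + k', k)%:R * omega (k + k') (m + m')
  = 2^-1 * (omega k m * omega k' m').
Proof.
move=> k0 k'0; have binE i j : ((i + j)`!%:R : R) = 'C(i + j, i)%:R * (i`!%:R * j`!%:R).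
  by rewrite -!natrM; have := bin_fact (leq_addr j i); rewrite addKn => ->.
have twoE : 2 ^+ (k + k').-1 = 2 * (2 ^+ k.-1 * 2 ^+ k'.-1) :> R.
  by rewrite -exprD -exprS; congr (_ ^+ _); lia.
have bin0 i j : ('C(i + j, i)%:R != 0 :> R) by rewrite pnatr_eq0 -lt0n bin_gt0 leq_addr.
have fact0 i : (i`!%:R != 0 :> R) by rewrite pnatr_eq0 -lt0n fact_gt0.
have two0 i : (2 ^+ i != 0 :> R) by rewrite expf_neq0 // pnatr_eq0.
rewrite /omega !natrM !natrX !binE twoE exprD.
by field; rewrite !bin0 !fact0 !two0.
Qed.

(** A stable graph has at most 2 h + n - 2 vertices. *)
Lemma total_sum_one_vertex N h n : (2 * h + n = 3)%N -> (3 * h + n <= N)%N ->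
  total_sum N h n = \sum_(m < 3 * h + n - 2) omega 1 m *: labelled_sum h n 1 m.
Proof.
move=> hn hN; have N1 : (1 < N)%N by lia.
have lN : (3 * h + n - 2 <= N)%N by lia.
rewrite /total_sum (bigD1 (Ordinal N1)) //= [X in _ + X]big1 ?addr0; last first.
  move=> k k1; apply: big1 => m _; rewrite labelled_sum0 ?scaler0 //.
  have {}k1 : nat_of_ord k != 1%N by apply: contraNneq k1 => k1; apply/eqP/val_inj.
  by case: (posnP k) => k0; rewrite ?orbT // orbF; apply/negP; lia.
rewrite [RHS](big_ord_widen N (fun m => omega 1 m *: labelled_sum h n 1 m)) // [RHS]big_mkcond.
apply: eq_bigr => m _; case: ifPn => // m_ge; rewrite labelled_sum0 ?scaler0 // orbF.
by apply/negP; lia.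
Qed.

Lemma total_sum0 N h n : (2 * h + n <= 2)%N -> total_sum N h n = 0.
Proof.
move=> hn; apply: big1 => k _; apply: big1 => m _; rewrite labelled_sum0 ?scaler0 //.
by case: (posnP k) => k0; rewrite ?orbT // orbF; apply/negP; lia.
Qed.

(** The coefficients are 1/2 for the two orientations of the cut edge ([omegaS]) and,
    for bridges, 1/8: besides that 1/2, one for chi and one from [omegaD]. *)
Lemma sum_cut_total N g n : (3 * g + n <= N)%N ->
  \sum_(k < N) \sum_(m < N.+1) omega k m *:
    \sum_(G : graph g 'I_k 'I_m 'I_n | stable g G)
       \sum_(e < m) ((if conn G (~: [set e]) then 1 else 2^-1) : R) *:
          weight D nu (fun f s => if f == e then (if s == 0%N then 1 else 0) else w s) G
  = (2^-1 : R) *: (if g is h.+1 then total_sum N h (n + 2) else 0)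
    + (8^-1 : R) *: \sum_(h1 < g.+1) \sum_(h2 < g.+1 | (h1 + h2 == g)%N) \sum_(a < n.+1)
        (total_sum N h1 a.+1 * total_sum N h2 (n - a).+1) *+ 'C(n, a).
Proof.
move=> gnN.
transitivity (\sum_(k < N) \sum_(m < N) (2^-1 * omega k m) *:
  ((if g is h.+1 then labelled_sum h (n + 2) k m else 0)
   + (2^-1 : R) *: \sum_(h1 < g.+1) \sum_(h2 < g.+1 | (h1 + h2 == g)%N) \sum_(a < n.+1)
      (\sum_(i < k.+1) \sum_(j < m.+1)
        (labelled_sum h1 a.+1 i j * labelled_sum h2 (n - a).+1 (k - i) (m - j))
          *+ 'C(m, j) *+ 'C(k, i)) *+ 'C(n, a))).
  (* A graph without edges has no edge to cut; the others have m + 1 edges. *)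
  apply: eq_bigr => k _; rewrite big_ord_recl big1 ?scaler0 ?add0r => [|G _]; last by rewrite big_ord0.
  apply: eq_bigr => m _; rewrite -[nat_of_ord (lift ord0 m)]/m.+1 -omegaS [m.+1%:R * _]mulrC -[RHS]scalerA
    -sum_bridged_labelled; congr (_ *: _).
  under eq_bigr do under eq_bigr do rewrite (weight_cut D nu_perm) mul1r.
  rewrite sum_cut_stable; congr (_ *: (_ + _)).
  case: (g) => // h; rewrite stable_sum_genus_bound //; apply: (stable_sum_card D w nu_perm) => //.
  by rewrite card_sum !card_ord card_bool.
under eq_bigr do under eq_bigr do rewrite scalerDr.
under eq_bigr do rewrite big_split; rewrite big_split /=; congr (_ + _).
  case: (g) => [|h]; first by rewrite scaler0 big1 // => k _; rewrite big1 // => m _; rewrite scaler0.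
  rewrite scaler_sumr; apply: eq_bigr => k _; rewrite scaler_sumr; apply: eq_bigr => m _.
  by rewrite scalerA.
pose f h1 h2 a i i' j j' := (omega (i + i') (j + j')) *:
   (labelled_sum h1 a.+1 i j * labelled_sum h2 (n - a).+1 i' j') *+ 'C(j + j', j) *+ 'C(i + i', i) *+ 'C(n, a).
transitivity ((4^-1 : R) *: \sum_(k < N) \sum_(m < N)
   \sum_(h1 < g.+1) \sum_(h2 < g.+1 | (h1 + h2 == g)%N) \sum_(a < n.+1)
      (\sum_(i < k.+1) \sum_(j < m.+1) f h1 h2 a i (k - i)%N j (m - j)%N)).
  rewrite scaler_sumr; apply: eq_bigr => k _; rewrite scaler_sumr; apply: eq_bigr => m _.
  rewrite scalerA !scaler_sumr; apply: eq_bigr => h1 _; rewrite !scaler_sumr; apply: eq_bigr => h2 _.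
  rewrite !scaler_sumr; apply: eq_bigr => a _.
  rewrite -sumrMnl !scaler_sumr; apply: eq_bigr => i _.
  rewrite -sumrMnl !scaler_sumr; apply: eq_bigr => j _.
  have ik : (i <= k)%N by rewrite -ltnS.
  have jm : (j <= m)%N by rewrite -ltnS.
  rewrite /f !subnKC // -!scalerMnr scalerA; by congr (_ *: _ *+ _ *+ _ *+ _); field.
have -> : 8^-1 = 4^-1 * 2^-1 :> R by field.
rewrite -scalerA; congr (_ *: _).
rewrite [LHS]pair_big /= [LHS]exchange_big /= scaler_sumr; apply: eq_bigr => h1 _.
rewrite [LHS]exchange_big /= scaler_sumr; apply: eq_bigr => h2 /eqP h12.
rewrite [LHS]exchange_big /= scaler_sumr; apply: eq_bigr => a _.
rewrite -(pair_big predT predT (fun k m : 'I_N =>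
  \sum_(i < k.+1) \sum_(j < m.+1) f h1 h2 a i (k - i)%N j (m - j)%N)) /=.
have an : (a <= n)%N by rewrite -ltnS.
(* Otherwise one of the sides would have more vertices or edges than a stable graph
   can have. *)
have f0 i i' j j' : (N <= i + i')%N || (N <= j + j')%N -> f h1 h2 a i i' j j' = 0.
  move=> hN; rewrite /f; case: (boolP ((i + 2 <= 2 * h1 + a.+1)%N && (j + 3 <= 3 * h1 + a.+1)%N)) => [h|h];
    last first.
    by rewrite labelled_sum0 ?h // mul0r scaler0 !mul0rn.
  rewrite [X in _ * X]labelled_sum0 ?mulr0 ?scaler0 ?mul0rn //.
  by apply/orP; left; apply/negP; lia.
transitivity (\sum_(i < N) \sum_(i' < N) \sum_(j < N) \sum_(j' < N) f h1 h2 a i i' j j').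
  rewrite -(@sum_convolution _ _ (fun i i' => \sum_(j < N) \sum_(j' < N) f h1 h2 a i i' j j')); last first.
    by move=> i i' h; rewrite big1 // => j _; rewrite big1 // => j' _; rewrite f0 // h.
  apply: eq_bigr => k _; rewrite exchange_big; apply: eq_bigr => i _ /=.
  rewrite -(@sum_convolution _ _ (fun j j' => f h1 h2 a i (k - i)%N j j')) //.
  by move=> j j' h; rewrite f0 // h orbT.
rewrite /total_sum big_distrlr /= -sumrMnl scaler_sumr; apply: eq_bigr => i _.
rewrite -sumrMnl scaler_sumr; apply: eq_bigr => i' _.
rewrite big_distrlr /= -sumrMnl scaler_sumr; apply: eq_bigr => j _.
rewrite -sumrMnl scaler_sumr; apply: eq_bigr => j' _.
rewrite /f -scalerMnr; congr (_ *+ _).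
have [i0|i_gt0] := posnP i; first by rewrite labelled_sum0 ?i0 ?orbT // mul0r !scaler0 !mul0rn mul0r scaler0.
have [i0|i'_gt0] := posnP i'; first by rewrite [labelled_sum h2 _ _ _]labelled_sum0 ?i0 ?orbT // mulr0
  !scaler0 !mul0rn mulr0 scaler0.
rewrite -scalerAl -scalerAr !scalerA -mulrA -omegaD // !scale_mulrn -mulrA mulrC [X in (X * _)%R *: _]mulrC //.
Qed.

End LabelledSums.

(** * Graphs with one vertex *)
Section Rose.
Context {R : numFieldType} {K : comAlgType R}.
Variables (D : nat) (nu : nat -> seq nat -> K) (w : nat -> K).
Hypothesis nu_dim : forall h s, (sumn s + 3 != 3 * h + size s)%N -> nu h s = 0.

(** The graph with one vertex, m loops and n legs, of genus h if m <= h. *)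
Definition rose (h n m : nat) : graph h 'I_1 'I_m 'I_n :=
  ([ffun=> inord (h - m)], [ffun=> ord0], [ffun=> ord0]).

Lemma rose_hedges h n m v : hedges (rose h n m) v = setT.
Proof. by apply/setP => x; rewrite !inE (ord1 v) (ord1 (vtx _ _)) eqxx. Qed.

Lemma rose_legs h n m v : legs (rose h n m) v = setT.
Proof. by apply/setP => x; rewrite !inE (ord1 v) (ord1 (leg _ _)) eqxx. Qed.

Lemma rose_gen h n m v : gen (rose h n m) v = (h - m)%N :> nat.
Proof. by rewrite ffunE inordK // ltnS leq_subr. Qed.

Lemma labelled_one_vertex h n m : (m <= h)%N -> (2 < 2 * h + n)%N ->
  labelled_sum D nu w h n 1 m = weight D nu (fun=> w) (rose h n m).
Proof.
move=> mh hn; rewrite /labelled_sum /stable_sum (big_pred1 (rose h n m)) // => G.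
apply/idP/eqP => [/and4P [_ _ /eqP e _]|->].
  case: G e => [[ge ve] le] e; congr (_, _, _); apply/ffunP => x; rewrite ffunE.
  - apply/val_inj; rewrite /= inordK ?ltnS ?leq_subr // (_ : x = ord0); last exact: ord1.
    by move: e; rewrite big_ord1 !card_ord /gen /= => e; lia.
  - by rewrite [LHS]ord1.
  - by rewrite [LHS]ord1.
apply/and4P; split; first by rewrite card_ord.
- apply/forallP => u; apply/forallP => v; rewrite (ord1 u) (ord1 v); exact: connect0.
- by rewrite /has_genus big_ord1 rose_gen !card_ord; apply/eqP; lia.
apply/forallP => v; rewrite rose_gen rose_hedges rose_legs !cardsT card_prod !card_ord card_bool; lia.
Qed.

Lemma rose_decor h n m (d : {ffun 'I_m * bool -> 'I_D.+1}) v :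
  decor (rose h n m) d v = [seq nat_of_ord (d x) | x <- enum {: 'I_m * bool}] ++ nseq n 0%N.
Proof. by rewrite /decor rose_hedges rose_legs enum_setT -enumT cardsT card_ord. Qed.

Lemma rose0_weight h n :
  weight D nu (fun=> w) (rose h n 0) = nu h (nseq n 0%N).
Proof.
have E0 : enum {: 'I_0 * bool} = [::].
  by apply: size0nil; rewrite -cardE card_prod card_ord.
rewrite /weight (big_pred1 [ffun=> ord0]) => [|d]; last first.
  by apply/esym/eqP/ffunP => -[[]].
by rewrite big_ord1 big_ord0 mulr1 rose_gen subn0 rose_decor E0.
Qed.

(** A connected graph without edges has one vertex, and its factor is N_{h,n} at 0,
    which vanishes for reasons of degree unless 3h - 3 + n = 0. *)
Lemma labelled_no_edge h n k : (4 <= 2 * h + n)%N -> labelled_sum D nu w h n k 0 = 0.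
Proof.
move=> hn; case: k => [|[|k]]; first by rewrite labelled_sum0 ?orbT.
  rewrite labelled_one_vertex ?rose0_weight; try lia.
  by rewrite nu_dim // sumn_nseq size_nseq mul0n; apply/eqP; lia.
apply: big1 => G /and4P [_ /conn_card]; rewrite !card_ord; lia.
Qed.

Lemma omega_1_0 : omega 1 0 = 1 :> R.
Proof. by rewrite /omega expr0 !muln1 invr1 mulr1. Qed.

(** The only stable graph is a vertex of genus 0 with three legs. *)
Lemma total_0_3 N : (3 <= N)%N -> total_sum D nu w N 0 3 = nu 0 [:: 0; 0; 0]%N.
Proof.
move=> N3; rewrite total_sum_one_vertex // big_ord1 omega_1_0 scale1r.
by rewrite labelled_one_vertex // rose0_weight.
Qed.

(** The vertex of genus 1 with one leg contributes 0 for reasons of degree, and the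
    vertex of genus 0 with one leg and one loop has two automorphisms. *)
Lemma total_1_1 N : (4 <= N)%N ->
  total_sum D nu w N 1 1 = (2^-1 : R) *: (nu 0 [:: 0; 0; 0]%N * w 0%N).
Proof.
move=> N4; rewrite total_sum_one_vertex // big_ord_recl big_ord1.
rewrite !labelled_one_vertex // rose0_weight nu_dim // scaler0 add0r.
have enumE : size (enum {: 'I_1 * bool}) = 2%N by rewrite -cardE card_prod card_ord card_bool.
rewrite /weight (bigD1 [ffun=> ord0]) //= [X in _ *: (_ + X)]big1 ?addr0; last first.
  move=> d d0; rewrite big_ord1 rose_gen subnn rose_decor nu_dim ?mul0r //.
  apply: contraNN d0; rewrite size_cat size_map enumE sumn_cat sumnE big_map big_enum /= !addn0.
  rewrite muln0 add0n -[X in _ == X]add0n eqn_add2r sum_nat_eq0 => /forallP h.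
  by apply/eqP/ffunP => x; rewrite ffunE; apply/val_inj/eqP; exact: h.
rewrite !big_ord1 rose_gen subnn rose_decor !ffunE /=.
have -> : [seq nat_of_ord (([ffun=> ord0] : {ffun 'I_1 * bool -> 'I_D.+1}) x) | x <- enum {: 'I_1 * bool}] =
  [:: 0; 0]%N.
  rewrite -[RHS]/(nseq 2 0%N) -enumE; elim: (enum _) => //= x s ->.
  by rewrite ffunE.
by congr (_ *: _); rewrite /omega expr0 invr1 mul1r.
Qed.

End Rose.

Section Isomorphic.
Context {R : numFieldType} {K : comAlgType R}.
Variables (D : nat) (nu : nat -> seq nat -> K) (w : nat -> K).
Hypothesis nu_perm : forall h s t, perm_eq s t -> nu h s = nu h t.

Lemma isomorphic_weight g n k m (G G' : dgraph g n k m) :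
  isomorphic G G' ->
  weight D nu (fun=> w) (G' : numbered_graph g n k m)
  = weight D nu (fun=> w) (G : numbered_graph g n k m).
Proof. by case/isomorphicP=> p [q h]; apply: (iso_weight D nu_perm h). Qed.

(** An isomorphism permutes the edges and the bridges among them. *)
Lemma isomorphic_cut_weight g n k m (G G' : graph g 'I_k 'I_m 'I_n) :
  isomorphic (g := g) (n := n) (k := k) (m := m) G G' ->
  let F (G : graph g 'I_k 'I_m 'I_n) := \sum_(e < m) ((if conn G (~: [set e]) then 1 else 2^-1) : R) *:
      weight D nu (fun f s => if f == e then (if s == 0%N then 1 else 0) else w s) G in
  F G' = F G.
Proof.
case/isomorphicP=> p [q h] /=; have sI := bij_inj (iso_edge_bij h).
rewrite (reindex (fun e => (q (e, false)).1)) /=; last exact: onW_bij (iso_edge_bij h).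
apply: eq_bigr => e _; apply: f_equal2.
  rewrite (iso_conn h (S := ~: [set e])) // => -[f c]; rewrite !inE (iso_edgeE h).
  by rewrite (inj_eq sI).
by apply: (iso_weight D nu_perm h) => f s; rewrite (inj_eq sI).
Qed.

End Isomorphic.

(** * Graph polynomials as weights *)
Lemma scale_in_alg (R : nzRingType) (A : lalgType R) (B : algType A) (c : R) (a : A) (x y : B) :
  c%:A *: (x * (a *: y)) = (c *: a) *: (x * y).
Proof. by rewrite -scalerAr scalerA -scalerAl mul1r. Qed.

Lemma prod_in_alg (R : comNzRingType) (A : comAlgType R) (I : Type) (r : seq I)
    (P : pred I) (c : I -> R) :
  \prod_(i <- r | P i) (c i)%:A = (\prod_(i <- r | P i) c i)%:A :> A.
Proof. by rewrite scaler_prod big1_eq. Qed.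

Section Zop.
Context {R : realType} {m : nat}.
Local Notation K := (formal_poly R).
Implicit Types p : {mpoly K[m]}.

Definition Zmonom (u : 'X_{1..m}) : R := \prod_i ((u i)`!%:R * zeta R (u i).+1).

(** Any list that contains the support may be used, which makes Z additive. *)
Lemma ZopE (s : seq 'X_{1..m}) p : uniq s -> {subset msupp p <= s} ->
  Zop p = \sum_(u <- s) Zmonom u *: p@_u.
Proof.
move=> s_uniq ps; rewrite [RHS](bigID (fun u => u \in msupp p)) /= [X in _ + X]big1 ?addr0.
  rewrite -big_filter /Zop; apply: perm_big; apply: uniq_perm.
  - exact: msupp_uniq.
  - exact: filter_uniq.
  - by move=> u; rewrite mem_filter; case: (boolP (u \in msupp p)) => // /ps ->.
by move=> u; rewrite -mcoeff_eq0 => /eqP ->; rewrite scaler0.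
Qed.

Lemma Zop_sum (I : finType) (c : I -> K) (u : I -> 'X_{1..m}) :
  Zop (\sum_i c i *: 'X_[u i]) = \sum_i Zmonom (u i) *: c i.
Proof.
rewrite (@ZopE (undup [seq u i | i <- enum I])) ?undup_uniq //; last first.
  move=> x; rewrite mem_undup => /msupp_sum_le /flatten_mapP [i _ /msuppZ_le].
  by rewrite msuppX inE => /eqP ->; rewrite map_f // mem_enum.
under eq_bigr do rewrite raddf_sum scaler_sumr /=.
rewrite exchange_big; apply: eq_bigr => i _ /=.
have us : u i \in undup [seq u j | j <- enum I] by rewrite mem_undup map_f // mem_enum.
rewrite (bigD1_seq (u i) us (undup_uniq _)) /=.
rewrite mcoeffZ mcoeffX eqxx mulr1 big1 ?addr0 // => x xu.
by rewrite mcoeffZ mcoeffX eq_sym (negPf xu) mulr0 scaler0.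
Qed.

End Zop.

(** Summing over exponents of the half-edges in H instead of exponents of the
    positions in the list of half-edges and legs at a vertex. *)
Lemma sum_positions (M : nmodType) (T : finType) (H : {set T}) (l D : nat)
    (F : seq nat -> M) :
  (forall s i, (#|H| <= i < #|H| + l)%N -> nth 0%N s i != 0%N -> F s = 0) ->
  \sum_(d : {ffun 'I_(#|H| + l) -> 'I_D.+1}) F [seq nat_of_ord (d i) | i <- enum 'I_(#|H| + l)]
  = \sum_(d : {ffun T -> 'I_D.+1} | [forall x, (x \notin H) ==> (d x == ord0)])
      F ([seq nat_of_ord (d x) | x <- enum H] ++ nseq l 0%N).
Proof.
move=> F0; set N := (#|H| + l)%N.
pose Q (d : {ffun 'I_N -> 'I_D.+1}) := [forall i : 'I_N, (#|H| <= i)%N ==> (d i == ord0)].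
pose up (d : {ffun T -> 'I_D.+1}) : {ffun 'I_N -> 'I_D.+1} :=
  [ffun i => nth ord0 [seq d x | x <- enum H] (nat_of_ord i)].
(* The positions below #|H| enumerate H, and those beyond have exponent 0. *)
pose down (d : {ffun 'I_N -> 'I_D.+1}) : {ffun T -> 'I_D.+1} :=
  [ffun x => if x \in H then nth ord0 [seq d i | i <- enum 'I_N] (index x (enum H)) else ord0].
have szH : size (enum H) = #|H| by rewrite -cardE.
have nthN (d : {ffun 'I_N -> 'I_D.+1}) (i : 'I_N) : nth ord0 [seq d i | i <- enum 'I_N] i = d i.
  by rewrite (nth_map i) ?size_enum_ord ?nth_ord_enum.
rewrite (bigID Q) /= [X in _ + X]big1 ?addr0; last first.
  move=> d /forallPn [i]; rewrite negb_imply => /andP [iH di]; apply: (F0 _ i); first by rewrite iH ltn_ord.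
  by rewrite (nth_map i) ?size_enum_ord ?nth_ord_enum.
rewrite (reindex_onto up down) /=; last first.
  move=> d /forallP dQ; apply/ffunP => i; rewrite ffunE.
  case: (ltnP i #|H|) => iH; last first.
    by rewrite nth_default ?size_map ?szH //; have := implyP (dQ i) iH => /eqP ->.
  have x0 := enum_val (Ordinal iH).
  rewrite (nth_map x0) ?szH // ffunE -mem_enum mem_nth ?szH // index_uniq ?szH ?enum_uniq //.
apply: eq_big => [d|d /andP [_ /eqP dK]].
  have upQ : Q (up d).
    apply/forallP => i; apply/implyP => iH; rewrite ffunE nth_default //.
    by rewrite size_map szH.
  rewrite upQ /=; apply/eqP/forallP => [<- x|dH].
    by apply/implyP => /negPf xH; rewrite ffunE xH.
  apply/ffunP => x; rewrite ffunE; case: ifPn => xH; last by have := implyP (dH x) xH => /eqP ->.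
  have ix : (index x (enum H) < #|H|)%N by rewrite -szH index_mem mem_enum.
  have iN : (index x (enum H) < N)%N by apply: leq_trans ix (leq_addr _ _).
  rewrite (nthN _ (Ordinal iN)) ffunE /= (nth_map x) ?szH // nth_index // mem_enum //.
congr (F _); apply: (@eq_from_nth _ 0%N).
 by rewrite size_map size_enum_ord size_cat size_map size_nseq szH.
move=> i; rewrite size_map size_enum_ord => iN.
rewrite (nth_map (Ordinal iN)) ?size_enum_ord // (nth_ord_enum _ (Ordinal iN)) ffunE /=.
rewrite nth_cat size_map szH; case: ltnP => iH; last first.
  by rewrite nth_default ?size_map ?szH // nth_nseq if_same.
have x0 := enum_val (Ordinal iH).
by rewrite !(nth_map x0) ?szH.
Qed.

Lemma sum_exponent_bound (M : nmodType) N B D (F : seq nat -> M) c :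
  (c <= B)%N -> (B <= D.+1)%N ->
  \sum_(d : {ffun 'I_N -> 'I_B} | (\sum_i d i + 3 == c)%N) F [seq nat_of_ord (d i) | i <- enum 'I_N]
  = \sum_(d : {ffun 'I_N -> 'I_D.+1} | (\sum_i d i + 3 == c)%N)
      F [seq nat_of_ord (d i) | i <- enum 'I_N].
Proof.
case: B => [|B] cB BD; first by rewrite !big_pred0 // => d; apply/negP => /eqP; lia.
pose up (d : {ffun 'I_N -> 'I_B.+1}) : {ffun 'I_N -> 'I_D.+1} := [ffun i => widen_ord BD (d i)].
pose down (d : {ffun 'I_N -> 'I_D.+1}) : {ffun 'I_N -> 'I_B.+1} := [ffun i => inord (d i)].
rewrite [RHS](reindex_onto up down) /=; last first.
  move=> d /eqP dc; apply/ffunP => i; rewrite !ffunE; apply/val_inj => /=; rewrite inordK //.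
  by move: dc; rewrite (bigD1 i) //=; lia.
apply: eq_big => [d|d _].
  rewrite (_ : \sum_i up d i = \sum_i d i)%N; last by apply: eq_bigr => i _; rewrite ffunE.
  rewrite andb_idr // => _; apply/eqP/ffunP => i; rewrite !ffunE; apply/val_inj.
  by rewrite /= inordK.
by congr (F _); apply: eq_map => i; rewrite ffunE.
Qed.

Section Factors.
Context {R : realType}.
Local Notation K := (formal_poly R).

(** The coefficient of prod_i b_i^(2 s_i) in N, and 0 if s does not have the degree
    required by N. Half-edge exponents may then be summed over without constraint. *)
Definition vertex_factor (h : nat) (s : seq nat) : K :=
  if (sumn s + 3 == 3 * h + size s)%N then
    (2 ^+ (5 * h + 2 * size s - 6) * \prod_(x <- s) x`!%:R : R)^-1 *: tau R s
  else 0.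

Lemma vertex_factor_perm h s t : perm_eq s t -> vertex_factor h s = vertex_factor h t.
Proof.
move=> st; rewrite /vertex_factor (perm_sumn st) (perm_size st) (perm_big _ st) /=.
by rewrite /tau (eq_seq_msetP _ _ st).
Qed.

(** The value (2s+1)! zeta(2s+2) of Z on b_e^(2s+1). *)
Definition edge_factor (s : nat) : K :=
  (((2 * s).+1)`!%:R * zeta R (2 * s).+2 : R)%:A.

(** Entries 0 of the tuple t, at positions beyond H, force the exponents there to
    vanish, and what remains is a sum over exponents at the elements of H. *)
Lemma Npoly_comp (m h D : nat) (T : finType) (H : {set T}) (l : nat) (f : T -> {mpoly K[m]})
    (t : seq {mpoly K[m]}) :
  t = [seq f x | x <- enum H] ++ nseq l 0 -> (3 * h + size t <= D.+1)%N ->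
  Npoly R h (size t) \mPo in_tuple t
  = \sum_(d : {ffun T -> 'I_D.+1} | [forall x, (x \notin H) ==> (d x == ord0)])
      vertex_factor h ([seq nat_of_ord (d x) | x <- enum H] ++ nseq l 0%N)
        *: \prod_(x in H) f x ^+ (2 * d x).
Proof.
move=> tE tD; have szH : size (enum H) = #|H| by rewrite -cardE.
have szt : size t = (#|H| + l)%N by rewrite tE size_cat size_map size_nseq szH.
pose F (s : seq nat) : {mpoly K[m]} := vertex_factor h s *: \prod_(i < size t) t`_i ^+ (2 * nth 0%N s i).
have sums N B (d : {ffun 'I_N -> 'I_B}) : sumn [seq nat_of_ord (d i) | i <- enum 'I_N] = (\sum_i d i)%N.
  by rewrite sumnE big_map big_enum.
transitivity (\sum_(d : {ffun 'I_(size t) -> 'I_D.+1} | (\sum_i d i + 3 == 3 * h + size t)%N)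
    F [seq nat_of_ord (d i) | i <- enum 'I_(size t)]).
  rewrite -(@sum_exponent_bound _ _ (3 * h + size t)) // /Npoly raddf_sum.
  apply: eq_bigr => d dc; rewrite /F /= comp_mpolyZ rmorph_prod /= /vertex_factor.
  rewrite sums.
  rewrite size_map size_enum_ord.
  rewrite dc.
  rewrite big_map.
  rewrite big_enum /=.
  congr (_ *: _).
  apply: eq_bigr => i _; rewrite rmorphXn /= comp_mpolyXU (nth_map i) ?size_enum_ord //.
  by rewrite nth_ord_enum.
transitivity (\sum_(d : {ffun 'I_(size t) -> 'I_D.+1}) F [seq nat_of_ord (d i) | i <- enum 'I_(size t)]).
  rewrite big_mkcond; apply: eq_bigr => d _; case: ifPn => // /negPf dc.
  by rewrite /F /vertex_factor sums size_map size_enum_ord dc scale0r.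
rewrite szt (@sum_positions _ _ H l D F); last first.
  move=> s i; rewrite -szt => /andP [iH it] si; rewrite /F.
  rewrite (bigD1 (Ordinal it)) //= {1}tE nth_cat size_map szH ltnNge iH /= nth_nseq if_same.
  by rewrite expr0n muln_eq0 /= (negPf si) mul0r scaler0.
apply: eq_bigr => d _; rewrite /F; congr (_ *: _).
rewrite szt big_split_ord /= [X in _ * X]big1 ?mulr1; last first.
  move=> i _; rewrite [nth 0%N _ _]nth_cat size_map szH ltnNge leq_addr /= nth_nseq if_same.
  by rewrite muln0 expr0.
rewrite [RHS]big_enum_val; apply: eq_bigr => i _.
have iH : (i < size (enum H))%N by rewrite szH.
have -> : nth 0%N ([seq nat_of_ord (d x) | x <- enum H] ++ nseq l 0%N) (lshift l i) = d (enum_val i).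
  rewrite nth_cat size_map szH /= ltn_ord.
  rewrite (nth_map (enum_val i)) //.
  by rewrite -(enum_val_nth (enum_val i)).
have -> : t`_(lshift l i) = f (enum_val i).
  rewrite tE nth_cat size_map szH /= ltn_ord.
  rewrite (nth_map (enum_val i)) //.
  by rewrite -(enum_val_nth (enum_val i)).
reflexivity.
Qed.

Section GraphPolynomial.
Context {g n k m : nat}.
Variables (G : dgraph g n k m) (D : nat).
Hypothesis valencyD : forall v, (3 * vgenus G v + valency G v <= D.+1)%N.

(** The edge e has the factor b_e of P_Gamma and the powers b_e^(2 d) from its two
    halves. *)
Definition exponents (d : {ffun 'I_m * bool -> 'I_D.+1}) : 'X_{1..m} :=
  [multinom (2 * (d (e, false) + d (e, true))).+1 | e < m].

Definition decoration_factor (d : {ffun 'I_m * bool -> 'I_D.+1}) : K :=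
  \prod_(v < k) vertex_factor (vgenus G v) (decor (G : numbered_graph g n k m) d v).

(** Distributing the product over the sums at the vertices: as every half-edge
    belongs to exactly one vertex, a family of exponents at each vertex is the same
    as a single function on half-edges. *)
Lemma vertex_product :
  \prod_(v < k) (Npoly R (vgenus G v) (size (bvec G v)) \mPo in_tuple (bvec G v))
  = \sum_(d : {ffun 'I_m * bool -> 'I_D.+1}) decoration_factor d *:
      \prod_(x : 'I_m * bool) ('X_(x.1) ^+ (2 * d x) : {mpoly K[m]}).
Proof.
pose H v := halfedges_at G v.
transitivity (\prod_(v < k) \sum_(d : {ffun 'I_m * bool -> 'I_D.+1} | [forall x, (x \notin H v) ==> (d x == ord0)])
      vertex_factor (vgenus G v) (decor (G : numbered_graph g n k m) d v)
        *: \prod_(x in H v) ('X_(x.1) ^+ (2 * d x) : {mpoly K[m]})).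
  apply: eq_bigr => v _; apply: (Npoly_comp (f := fun x => 'X_(x.1))); last by rewrite size_bvec.
  rewrite /bvec; congr (_ ++ _); rewrite -[#|_|]/(#|legs_at G v|) cardE.
  by elim: (enum _) => //= i s ->.
rewrite bigA_distr_big_dep.
pose f (d : {ffun 'I_m * bool -> 'I_D.+1}) : {ffun 'I_k -> {ffun 'I_m * bool -> 'I_D.+1}} :=
  [ffun v => [ffun x => if x \in H v then d x else ord0]].
rewrite (reindex_onto f (fun h => [ffun x => h (vertex_of G x) x])) /=; last first.
  move=> h /familyP hf; apply/ffunP => v; apply/ffunP => x; rewrite !ffunE.
  case: ifPn => [|xv]; first by rewrite inE => /eqP ->.
  by have /forallP /(_ x) := hf v; rewrite xv => /eqP ->.
apply: eq_big => [d|d _].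
  apply/andP; split; last by apply/eqP/ffunP => x; rewrite !ffunE inE eqxx.
  by apply/familyP => v; apply/forallP => x; apply/implyP => xv; rewrite !ffunE (negPf xv).
rewrite scaler_prod.
apply: f_equal2.
  apply: eq_bigr => v _; congr (vertex_factor _ (_ ++ _)); apply/eq_in_map => x; rewrite mem_enum => xv.
  by rewrite !ffunE /H -[_ \in halfedges_at _ _]/(x \in hedges (G : numbered_graph g n k m) v) xv.
rewrite [RHS](partition_big (vertex_of G) predT) //=; apply: eq_bigr => v _.
by apply: eq_big => x; rewrite !inE // => xv; rewrite !ffunE inE xv.
Qed.

Local Notation PG := (Pconst (R := R) G).

Lemma Pgraph_expand :
  Pgraph R G = if (m == 0)%N && (4 <= 2 * g + n)%N then 0 else
    \sum_(d : {ffun 'I_m * bool -> 'I_D.+1}) (PG *: decoration_factor d) *: 'X_[exponents d].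
Proof.
rewrite /Pgraph; case: ifP => _; first by [].
rewrite vertex_product.
rewrite big_distrr [LHS]scaler_sumr; apply: eq_bigr => d _.
rewrite [LHS]scale_in_alg; apply: f_equal.
rewrite [RHS]mpolyXE_id (eq_bigr (fun x : 'I_m * bool => 'X_(x.1) ^+ (2 * d (x.1, x.2)))); last by case.
rewrite -(pair_big predT predT (fun e c => 'X_e ^+ (2 * d (e, c)))) /= -big_split /=.
by apply: eq_bigr => e _; rewrite mnmE big_bool /= -exprD -exprS mulnDr addnC.
Qed.

Lemma Zop_Pgraph : (m == 0)%N && (4 <= 2 * g + n)%N = false ->
  Zop (Pgraph R G) = PG *:
    weight D vertex_factor (fun _ => edge_factor) (G : numbered_graph g n k m).
Proof.
move=> mgn; rewrite Pgraph_expand mgn Zop_sum /weight scaler_sumr; apply: eq_bigr => d _.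
rewrite scalerA mulrC -scalerA; congr (_ *: _).
rewrite /edge_factor prod_in_alg mulr_algr; apply: f_equal2; last by [].
by apply: eq_bigr => e _; rewrite mnmE.
Qed.

Lemma set_zeroX (u : 'X_{1..m}) e :
  set_zero e ('X_[u] : {mpoly K[m]}) = if u e == 0%N then 'X_[u] else 0.
Proof.
rewrite /set_zero comp_mpolyX; case: ifPn => ue; last first.
  by rewrite (bigD1 e) //= tnth_mktuple eqxx expr0n (negPf ue) mul0r.
rewrite mpolyXE_id; apply: eq_bigr => i _; rewrite tnth_mktuple.
by case: eqP => [->|//]; rewrite (eqP ue) !expr0.
Qed.

Lemma derivative_at_zero (d : {ffun 'I_m * bool -> 'I_D.+1}) e :
  'X_e * set_zero e ('X_[exponents d] : {mpoly K[m]})^`M(e)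
  = if (d (e, false) + d (e, true) == 0)%N then 'X_[exponents d] else 0.
Proof.
rewrite mderivX /set_zero comp_mpolyZ -/(set_zero e _) set_zeroX mnmBE mnmE mnm1E eqxx subn1 /=.
rewrite muln_eq0 /=; case: ifPn => [/eqP ->|_]; last by rewrite scaler0 mulr0.
rewrite scale1r -mpolyXD; congr 'X_[_]; rewrite addmC submK //.
by apply/mnm_lepP => i; rewrite mnm1E mnmE; case: eqP.
Qed.

(** The edge e has the factor 1 on the right, instead of zeta(2), which is put into
    the constant. *)
Lemma Zop_partial :
  Zop (partial_graph G (Pgraph R G)) = (PG * zeta R 2) *: \sum_(e < m)
    ((if conn (G : numbered_graph g n k m) (~: [set e]) then 1 else 2^-1) : R) *:
      weight (b := g) (V := 'I_k) (E := 'I_m) (L := 'I_n) D vertex_factor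
        (fun f s => if f == e then (if s == 0%N then 1 else 0) else edge_factor s) G.
Proof.
case: (posnP m) => [m0|m_gt0].
  have I0 (e : 'I_m) : False by have := leq_trans (ltn_ord e) (eq_leq m0).
  rewrite /partial_graph [X in Zop X]big1; last by move=> e; case: (I0 e).
  rewrite [X in _ = _ *: X]big1; last by move=> e; case: (I0 e).
  by rewrite scaler0 /Zop msupp0 big_nil.
rewrite /partial_graph Pgraph_expand eqn0Ngt m_gt0 /=.
pose c (ed : 'I_m * {ffun 'I_m * bool -> 'I_D.+1}) : K :=
  if (ed.2 (ed.1, false) + ed.2 (ed.1, true) == 0)%N
  then chi G ed.1 *: (PG *: decoration_factor ed.2) else 0.
rewrite (_ : \sum_(e < m) _ = \sum_ed c ed *: 'X_[exponents ed.2]); last first.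
  rewrite -(pair_big predT predT (fun e d => c (e, d) *: 'X_[exponents d])) /=.
  apply: eq_bigr => e _.
  rewrite (big_morph (fun p : {mpoly K[m]} => set_zero e p^`M(e)) (id1 := 0) (op1 := +%R)); first last.
  - by rewrite mderiv0 /set_zero comp_mpoly0.
  - by move=> p q; rewrite mderivD /set_zero comp_mpolyD.
  rewrite mulr_sumr [LHS]scaler_sumr; apply: eq_bigr => d _.
  rewrite mderivZ /set_zero comp_mpolyZ -/(set_zero e _) [LHS]scale_in_alg derivative_at_zero /c /=.
  by case: ifP => _; [ | rewrite scaler0 scale0r].
rewrite Zop_sum -(pair_big predT predT (fun e d => Zmonom (exponents d) *: c (e, d))) /= scaler_sumr.
apply: eq_bigr => e _.
have chiE : chi G e = if conn (G : numbered_graph g n k m) (~: [set e]) then 1 else 2^-1.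
  rewrite /chi /is_bridge /connected_by; case: (vertex_of G (e, false)) => v /(leq_ltn_trans (leq0n _)) -> /=.
  by rewrite -[X in ~~ X]/(conn (G : numbered_graph g n k m) (~: [set e])); case: conn.
rewrite /weight [RHS]scalerA [RHS]scaler_sumr; apply: eq_bigr => d _; rewrite /c /= chiE.
rewrite [X in _ = _ *: (_ * X)](bigD1 e isT).
rewrite (eqxx e) /=.
case: ifPn => [/eqP de|_]; last by rewrite mul0r mulr0 [LHS]scaler0 [RHS]scaler0.
rewrite mul1r [X in _ *: X]scalerA [LHS]scalerA.
rewrite (eq_bigr (fun f : 'I_m => edge_factor (d (f, false) + d (f, true)))); last first.
  by move=> f /negPf ->.
rewrite /edge_factor prod_in_alg mulr_algr scalerA; apply: f_equal2; last by [].
rewrite /Zmonom (bigD1 e) //= mnmE de muln0 (_ : 1`!%:R = 1 :> R) // mul1r.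
rewrite (eq_bigr (fun f : 'I_m => (2 * (d (f, false) + d (f, true))).+1`!%:R * zeta R (2 * (d (f, false) + d
  (f, true))).+2)); last first.
  by move=> f _; rewrite mnmE.
rewrite [LHS]mulrAC; apply: f_equal2; last by [].
by rewrite [LHS]mulrCA [RHS]mulrC [PG * _]mulrC.
Qed.

End GraphPolynomial.

End Factors.

(** * Volumes and comparison of the constants *)
Section Volumes.
Context {R : realType}.
Local Notation K := (formal_poly R).
Variable D : nat.
Local Notation nu := (@vertex_factor R).
Local Notation ew := (@edge_factor R).
Local Notation total := (total_sum D nu ew).
Local Notation labelled := (labelled_sum D nu ew).

Lemma vertex_factor_dim h s : (sumn s + 3 != 3 * h + size s)%N -> nu h s = 0.
Proof. by move=> /negPf e; rewrite /vertex_factor e. Qed.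

Lemma vertex_factor_000 : nu 0 [:: 0; 0; 0]%N = tau R [:: 0; 0; 0]%N.
Proof.
rewrite /vertex_factor /= muln0 expr0.
rewrite !big_cons big_nil.
rewrite !mulr1.
rewrite invr1.
by rewrite scale1r.
Qed.

(** The constant of P_Gamma, extended to (0,3) through the convention for the ratio
    of factorials: its value 4 there, like its value 8 at (1,1), is the one that makes
    [formal_volumeE] hold. *)
Definition volume_constant h n : R := 2 ^+ (6 * h + 2 * n - 5) / dl_ratio R h n.

Lemma dl_ratio_neq0 h n : dl_ratio R h n != 0.
Proof.
rewrite /dl_ratio; case: ifP => _; rewrite ?invr_eq0 ?pnatr_eq0 //.
by rewrite mulf_neq0 // ?invr_eq0 pnatr_eq0 -lt0n fact_gt0.
Qed.

(** The bound on the exponents at v: the degree 3 g_v - 3 + n_v of N at v is less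
    than D + 1, because v has at most 2 m + n half-edges and legs. *)
Lemma valency_bound g n k m (G : dgraph g n k m) v : (m < 3 * g + n)%N -> (9 * g + 3 * n <= D)%N ->
  (3 * vgenus G v + valency G v <= D.+1)%N.
Proof.
move=> m_lt gnD; have := sum_valency G; rewrite (bigD1 v) //=.
by have := ltn_ord (vgenus G v); lia.
Qed.

Lemma formal_volumeE N h n : (2 < 2 * h + n)%N -> (0 < n)%N || (1 < h)%N ->
  (9 * h + 3 * n <= D)%N -> (3 * h + n <= N)%N ->
  formal_volume R h n = volume_constant h n *: total N h n.
Proof.
move=> hn hn' hD hN; rewrite /formal_volume.
case: ifP => [/andP [/eqP h0 /eqP n3]|no3].
  have -> : volume_constant h n = 4.
    by rewrite h0 n3 /volume_constant /dl_ratio /= invrK -natrX -natrM.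
  rewrite h0 n3 total_0_3 ?vertex_factor_000; first by [].
  by move: hN; rewrite h0 n3.
case: ifP => [/andP [/eqP h1 /eqP n1]|no1].
  have -> : volume_constant h n = 8.
    by rewrite h1 n1 /volume_constant /dl_ratio /= !divr1 -natrX.
  rewrite h1 n1 (total_1_1 D ew vertex_factor_dim); last by move: hN; rewrite h1 n1.
  rewrite vertex_factor_000 /edge_factor mulr_algr [RHS]scalerA [RHS]scalerA muln0 zeta2.
  apply: f_equal2; last by [].
  by rewrite (_ : 1`!%:R = 1 :> R) // mul1r; move: (pi ^+ 2 : R) => x; field.
have hn4 : (4 <= 2 * h + n)%N.
  by move: no3 no1 hn hn'; case: (h) (n) => [|[|h']] [|[|[|[|n']]]]; lia.
pose A : R := 2 ^+ (6 * h + 2 * n - 5) * (4 * h + n - 4)`!%:R / (6 * h + 2 * n - 7)`!%:R.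
pose F k m (G : dgraph h n k m) : K := if (m == 0)%N then 0 else
  (A * (2 ^+ k.-1)^-1) *: weight D nu (fun=> ew) (G : numbered_graph h n k m).
transitivity (\sum_(G in stable_graphs h n) (#|graph_automorphisms (tagged G)|%:R^-1 : R) *: F _ _ (tagged G)).
  apply: eq_bigr => -[[k m] G] _ /=; rewrite /F.
  case: (boolP (m == 0 :> nat)) => [m0|m0].
    by rewrite /Pgraph m0 hn4 /= scaler0 /Zop msupp0 big_nil.
  have vD v : (3 * vgenus G v + valency G v <= D.+1)%N by exact: valency_bound.
  rewrite (Zop_Pgraph vD); last by rewrite (negPf m0).
  rewrite [RHS]scalerA; apply: f_equal2; last by [].
  by rewrite /Pconst /A mulrC.
have F_iso k m (G G' : dgraph h n k m) : isomorphic G G' -> F k m G' = F k m G.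
  move=> GG'; have e := isomorphic_weight D ew (@vertex_factor_perm R) GG'.
  by rewrite /F e.
have kN : (2 * h + n <= N)%N by lia.
rewrite (sum_stable_graphs F_iso kN hN).
have -> : volume_constant h n = A.
  rewrite /volume_constant /dl_ratio ifF // /A invf_div mulrA //.
rewrite /total_sum [RHS]scaler_sumr; apply: eq_bigr => k _.
rewrite [RHS]scaler_sumr; apply: eq_bigr => m _; rewrite [RHS]scalerA.
case: (posnP m) => [m0|m_gt0].
  rewrite [X in _ *: X](_ : _ = 0); last first.
    by apply: big1 => G _; rewrite /F ifT //; apply/eqP.
  have L0 : labelled h n k m = 0 by rewrite m0; apply: labelled_no_edge => //; exact: vertex_factor_dim.
  by rewrite L0 [LHS]scaler0 [RHS]scaler0.
rewrite (eq_bigl (fun G : numbered_graph h n k m => stable h G)); last by move=> G; exact: is_stableE.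
rewrite /labelled_sum /stable_sum /F eqn0Ngt m_gt0 /=.
rewrite -[X in _ *: X = _]scaler_sumr [LHS]scalerA.
apply: f_equal2; last by [].
rewrite /omega; ring.
Qed.

Lemma volume_constantE h n : (4 <= 2 * h + n)%N ->
  volume_constant h n = 2 ^+ (6 * h + 2 * n - 5) * (4 * h + n - 4)`!%:R / (6 * h + 2 * n - 7)`!%:R.
Proof.
move=> hn; rewrite /volume_constant /dl_ratio ifF ?invf_div ?mulrA //.
by apply/negP => /andP [/eqP h0 /eqP n3]; move: hn; rewrite h0 n3.
Qed.

Lemma sum_Zop_partial N g n : (4 <= 2 * g + n)%N -> (9 * g + 3 * n <= D)%N -> (3 * g + n <= N)%N ->
  \sum_(G in stable_graphs g n) Zop (partial_graph (tagged G) (Pgraph R (tagged G)))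
  = (volume_constant g n * zeta R 2) *:
    ((2^-1 : R) *: (if g is h.+1 then total N h (n + 2) else 0)
    + (8^-1 : R) *: \sum_(h1 < g.+1) \sum_(h2 < g.+1 | (h1 + h2 == g)%N) \sum_(a < n.+1)
        (total N h1 a.+1 * total N h2 (n - a).+1) *+ 'C(n, a)).
Proof.
move=> gn gD gN; rewrite -(sum_cut_total D ew (@vertex_factor_perm R) gN).
pose A : R := volume_constant g n * zeta R 2.
pose Fc k m (G : numbered_graph g n k m) : K := \sum_(e < m) ((if conn G (~: [set e]) then 1 else 2^-1) : R) *:
      weight D nu (fun f s => if f == e then (if s == 0%N then 1 else 0) else ew s) G.
pose F k m (G : dgraph g n k m) : K := (A * (2 ^+ k.-1)^-1) *: Fc k m G.
have F_iso k m (G G' : dgraph g n k m) : isomorphic G G' -> F k m G' = F k m G.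
  move=> GG'; have e := isomorphic_cut_weight D ew (@vertex_factor_perm R) GG'.
  exact: (f_equal (fun x => (A * (2 ^+ k.-1)^-1) *: x) e).
transitivity (\sum_(G in stable_graphs g n) (#|graph_automorphisms (tagged G)|%:R^-1 : R) *: F _ _ (tagged G)).
  apply: eq_bigr => -[[k m] G] _ /=; rewrite /F /Fc.
  have vD v : (3 * vgenus G v + valency G v <= D.+1)%N by exact: valency_bound.
  rewrite (Zop_partial vD) [RHS]scalerA; apply: f_equal2; last by [].
  rewrite /Pconst /A (volume_constantE gn); move: (zeta R 2) => z; ring.
have kN : (2 * g + n <= N)%N by lia.
rewrite (sum_stable_graphs F_iso kN (leqW gN)) [RHS]scaler_sumr; apply: eq_bigr => k _.
rewrite [RHS]scaler_sumr; apply: eq_bigr => m _; rewrite [RHS]scalerA.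
rewrite (eq_bigl (fun G : numbered_graph g n k m => stable g G)); last by move=> G; exact: is_stableE.
rewrite /F -[X in (_ *: X = _)]scaler_sumr [LHS]scalerA.
apply: f_equal2; last by [].
by rewrite /omega -/A; ring.
Qed.

(** The ratios of factorials in the products of volumes cancel against those in the
    volumes, and the exponent of 2 is additive up to 1, which leaves 1/2. *)
Lemma split_coefficient g n h1 h2 a : (4 <= 2 * g + n)%N -> (h1 + h2 = g)%N -> (a <= n)%N ->
  (6 <= 6 * h1 + 2 * a.+1)%N -> (6 <= 6 * h2 + 2 * (n - a).+1)%N ->
  (4 * g + n - 4)`!%:R
   * (n`!%:R / ((a.+1 - 1)`!%:R * ((n - a).+1 - 1)`!%:R))
   * (dl_ratio R h1 a.+1 * dl_ratio R h2 (n - a).+1 / (6 * g + 2 * n - 7)`!%:R)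
   * (volume_constant h1 a.+1 * volume_constant h2 (n - a).+1)
  = volume_constant g n * 2^-1 * 'C(n, a)%:R.
Proof.
move=> gn hg an hd1 hd2; rewrite (volume_constantE gn) /volume_constant.
have -> : n`!%:R = 'C(n, a)%:R * (a`!%:R * (n - a)`!%:R) :> R.
  by rewrite -!natrM bin_fact.
have -> : 2 ^+ (6 * g + 2 * n - 5)
    = 2 * (2 ^+ (6 * h1 + 2 * a.+1 - 5) * 2 ^+ (6 * h2 + 2 * (n - a).+1 - 5)) :> R.
  by rewrite -exprD -exprS; congr (_ ^+ _); lia.
rewrite !subn1 /=.
have d1 := dl_ratio_neq0 h1 a.+1; have d2 := dl_ratio_neq0 h2 (n - a).+1.
have f0 i : (i`!%:R != 0 :> R) by rewrite pnatr_eq0 -lt0n fact_gt0.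
move: (f0 a) (f0 (n - a)%N) (f0 (6 * g + 2 * n - 7)%N) d1 d2.
move: (a`!%:R : R) ((n - a)`!%:R : R) ((6 * g + 2 * n - 7)`!%:R : R) (dl_ratio _ _ _) (dl_ratio _ _ _).
move: (2 ^+ _ : R) (2 ^+ _ : R) => x y u v z d1 d2 u0 v0 z0 d10 d20.
by field; rewrite u0 v0 z0 d10 d20.
Qed.

(** Going from (g, n) to (g - 1, n + 2) lowers the exponent of 2 by 2 and turns the
    factorials of the volume into (l - 2)! and (d - 3)!. *)
Lemma loop_coefficient g n : (4 <= 2 * g + n)%N -> (0 < g)%N ->
  ((4 * g + n - 4)`!%:R / (4 * g + n - 6)`!%:R)
   * ((6 * g + 2 * n - 9)`!%:R / (6 * g + 2 * n - 7)`!%:R) * volume_constant (g - 1) (n + 2)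
  = volume_constant g n * 2^-1 * 2^-1.
Proof.
case: g => [//|h] hn _; rewrite subn1 /=; rewrite !volume_constantE //; last by lia.
have -> : (4 * h + (n + 2) - 4 = 4 * h.+1 + n - 6)%N by lia.
have -> : (6 * h + 2 * (n + 2) - 7 = 6 * h.+1 + 2 * n - 9)%N by lia.
have -> : 2 ^+ (6 * h.+1 + 2 * n - 5) = 2 * (2 * 2 ^+ (6 * h + 2 * (n + 2) - 5)) :> R.
  by rewrite -!exprS; congr (_ ^+ _); lia.
have f0 i : (i`!%:R != 0 :> R) by rewrite pnatr_eq0 -lt0n fact_gt0.
move: (f0 (4 * h.+1 + n - 6)%N) (f0 (6 * h.+1 + 2 * n - 9)%N) (f0 (6 * h.+1 + 2 * n - 7)%N).
move: ((4 * h.+1 + n - 6)`!%:R : R) ((6 * h.+1 + 2 * n - 9)`!%:R : R) ((6 * h.+1 + 2 * n - 7)`!%:R : R).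
move: (2 ^+ _ : R) ((4 * h.+1 + n - 4)`!%:R : R) => x y u v z u0 v0 z0.
by field; rewrite u0 v0 z0.
Qed.

(** 3 / pi^2 is half the inverse of zeta(2). *)
Lemma basel_coefficient g n :
  3 / pi ^+ 2 * (volume_constant g n * zeta R 2) = volume_constant g n * 2^-1.
Proof.
rewrite zeta2; have : pi ^+ 2 != 0 :> R by rewrite expf_neq0 // gt_eqF // pi_gt0.
by move: (pi ^+ 2 : R) (volume_constant _ _) => x c x0; field.
Qed.

(** Pairs with d_i < 0 are excluded on the left; the corresponding sums on the right
    vanish since there are no stable graphs to sum over. *)
Lemma sum_splittings N g n h1 h2 : (4 <= 2 * g + n)%N -> (h1 + h2 = g)%N ->
  (9 * g + 3 * n + 3 <= D)%N -> (3 * g + n + 1 <= N)%N ->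
  \sum_(n1 < n.+3)
    \sum_(n2 < n.+3 | [&& (n1 + n2 == n + 2)%N, (1 <= n1)%N, (1 <= n2)%N,
                            (6 <= 6 * h1 + 2 * n1)%N & (6 <= 6 * h2 + 2 * n2)%N])
        ((4 * g + n - 4)`!%:R
         * (n`!%:R / ((n1 - 1)`!%:R * (n2 - 1)`!%:R))
         * (dl_ratio R h1 n1 * dl_ratio R h2 n2 / (6 * g + 2 * n - 7)`!%:R))
        *: (formal_volume R h1 n1 * formal_volume R h2 n2)
  = (volume_constant g n * 2^-1) *:
    \sum_(a < n.+1) (total N h1 a.+1 * total N h2 (n - a).+1) *+ 'C(n, a).
Proof.
move=> gn hg gD gN.
rewrite (sum_leg_splittings n (fun n1 n2 => (6 <= 6 * h1 + 2 * n1)%N && (6 <= 6 * h2 + 2 * n2)%N)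
  (fun n1 n2 => ((4 * g + n - 4)`!%:R
         * (n`!%:R / ((n1 - 1)`!%:R * (n2 - 1)`!%:R))
         * (dl_ratio R h1 n1 * dl_ratio R h2 n2 / (6 * g + 2 * n - 7)`!%:R))
        *: (formal_volume R h1 n1 * formal_volume R h2 n2))).
rewrite [RHS]scaler_sumr; apply: eq_bigr => a _.
have an : (a <= n)%N by rewrite -ltnS.
case: ifPn => [/andP [hd1 hd2]|hd].
  rewrite (@formal_volumeE N h1 a.+1); [|lia..].
  rewrite (@formal_volumeE N h2 (n - a).+1); [|lia..].
  rewrite [LHS]scaled_product split_coefficient; [|lia..].
  by rewrite -[RHS]scalerMnr [RHS]scale_mulrn.
have -> : total N h1 a.+1 * total N h2 (n - a).+1 = 0.
  have [hd1|hd1] := ltnP (6 * h1 + 2 * a.+1) 6.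
    by rewrite [total N h1 _]total_sum0 ?mul0r //; lia.
  rewrite [total N h2 _]total_sum0 ?mulr0 //.
  by move: hd; rewrite hd1 /= -ltnNge; lia.
by rewrite mul0rn [RHS]scaler0.
Qed.

End Volumes.

Theorem theorem1p17 (R : realType) (g n : nat) (hgn : (4 <= 2 * g + n)%N) :
  ((1 <= g)%N ->
   (3 / pi ^+ 2 : R) *:
     (\sum_(G in stable_graphs g n) Zop (partial_graph (tagged G) (Pgraph R (tagged G))))
   =
   (8^-1 : R) *:
     (\sum_(g1 < g.+1) \sum_(g2 < g.+1 | (g1 + g2 == g)%N)
      \sum_(n1 < n.+3)
      \sum_(n2 < n.+3 | [&& (n1 + n2 == n + 2)%N, (1 <= n1)%N, (1 <= n2)%N,
                            (6 <= 6 * g1 + 2 * n1)%N & (6 <= 6 * g2 + 2 * n2)%N])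
        ((4 * g + n - 4)`!%:R
         * (n`!%:R / ((n1 - 1)`!%:R * (n2 - 1)`!%:R))
         * (dl_ratio R g1 n1 * dl_ratio R g2 n2 / (6 * g + 2 * n - 7)`!%:R))
        *: (formal_volume R g1 n1 * formal_volume R g2 n2))
   + (((4 * g + n - 4)`!%:R / (4 * g + n - 6)`!%:R)
      * ((6 * g + 2 * n - 9)`!%:R / (6 * g + 2 * n - 7)`!%:R))
     *: formal_volume R (g - 1) (n + 2))
  /\
  (g = 0%N ->
   (3 / pi ^+ 2 : R) *:
     (\sum_(G in stable_graphs 0 n) Zop (partial_graph (tagged G) (Pgraph R (tagged G))))
   =
   (8^-1 : R) *:
     (\sum_(n1 < n.+3)
      \sum_(n2 < n.+3 | [&& (n1 + n2 == n + 2)%N, (3 <= n1)%N & (3 <= n2)%N])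
        ((n - 4)`!%:R
         * (n`!%:R / ((n1 - 1)`!%:R * (n2 - 1)`!%:R))
         * (dl_ratio R 0 n1 * dl_ratio R 0 n2 / (2 * n - 7)`!%:R))
        *: (formal_volume R 0 n1 * formal_volume R 0 n2))).
Proof.
(* For genera h <= g with at most n + 2 legs when h < g, and with at most n + 1
   legs otherwise, D exceeds the exponents that occur and N the numbers of vertices
   and edges. *)
pose D := (9 * g + 3 * n + 3)%N; pose N := (3 * g + n + 1)%N.
have gD : (9 * g + 3 * n <= D)%N by rewrite leq_addr.
have gN : (3 * g + n <= N)%N by rewrite leq_addr.
pose T h m : formal_poly R := total_sum D (@vertex_factor R) (@edge_factor R) N h m.
have splitE h1 h2 := @sum_splittings R D N g n h1 h2 hgn.
split=> [g_gt0|g0].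
  rewrite (sum_Zop_partial hgn gD gN) [LHS]scalerA basel_coefficient.
  rewrite [LHS]scalerDr [LHS]addrC; apply: f_equal2.
    rewrite [LHS]scalerA mulrC -[LHS]scalerA; apply: f_equal.
    rewrite [LHS]scaler_sumr; apply: eq_bigr => h1 _.
    rewrite [LHS]scaler_sumr; apply: eq_bigr => h2 /eqP h12.
    by rewrite (splitE h1 h2 h12 (leqnn _) (leqnn _)).
  rewrite (@formal_volumeE R D N (g - 1) (n + 2)); [|lia..].
  rewrite [LHS]scalerA [RHS]scalerA.
  have predE (f : nat -> formal_poly R) : (if g is h.+1 then f h else 0) = f (g - 1)%N.
    by case: (g) g_gt0 => // h _; rewrite subn1.
  by rewrite (predE (fun h => T h (n + 2)%N)) (loop_coefficient hgn g_gt0).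
have := splitE 0%N 0%N; move: hgn gD gN; rewrite g0 => {}hgn {}gD {}gN {}splitE.
rewrite (sum_Zop_partial hgn gD gN) [LHS]scalerA basel_coefficient big_ord1 big_ord1_cond /=.
rewrite [X in _ *: (X + _)]scaler0 add0r [LHS]scalerA mulrC -[LHS]scalerA -splitE; last first.
- by rewrite /N g0.
- by rewrite /D g0.
- by [].
apply: f_equal; apply: eq_bigr => n1 _; apply: eq_big => [n2|n2 _].
  by case: eqP => //= e; apply/idP/idP; lia.
by rewrite !muln0 !add0n.
Qed.
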